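(* Let $\mathcal{H}=L^2([0,1])$ and let $\{X_t\}_{t\in\mathbb{Z}}$ be the stationary causal solution of the FAR(1) equation $X_t=\Psi X_{t-1}+\varepsilon_t$, $t\in\mathbb{Z}$, where $\Psi$ is a Hilbert--Schmidt operator on $\mathcal{H}$. Let $C_0=\mathbb{E}[X_t\otimes X_t]$. Assume: (1) $\|\Psi\|_{\mathrm{op}}<1$, and $\{\varepsilon_t\}$ is an i.i.d. sequence of $\mathcal{H}$-valued random elements with $\mathbb{E}\varepsilon_t=0$ and $\mathbb{E}\|\varepsilon_t\|^4<\infty$. (2) $C_0$ is injective, compact and of trace class, and its eigenvalues $\lambda_1\ge\lambda_2\ge\dots>0$ satisfy $c_1k^{-a}\le\lambda_k\le c_2k^{-a}$ for all $k\ge1$, for some constants $0<c_1\le c_2<\infty$ and $a>1$. (3) There exist constants $\beta>0$, $\rho<\infty$ and a Hilbert--Schmidt operator $F$ on $\mathcal{H}$ with $\|F\|_{\mathrm{HS}}\le\rho$ such that $\Psi=F\,C_0^{\beta}$. (4) $\{X_t\}$ is $L^4$-$m$-approximable. For $\alpha>0$ let $\widehat{\Psi}_\alpha=\widehat{C}_1(\widehat{C}_0+\alpha I)^{-1}$, where $\widehat C_0,\widehat C_1$ are the sample covariance and sample lag-one cross-covariance operators computed from $X_1,\dots,X_n$. Let $(\alpha_n)$ be a deterministic sequence of positive numbers with $$\alpha_n\asymp n^{-1/(2(\min(\beta,1)+1))}.$$ Then, as $n\to\infty$, $$\bigl\|\widehat{\Psi}_{\alpha_n}-\Psi\bigr\|_{\mathrm{HS}}=O_P\bigl(n^{-\min(\beta,1)/(2(\min(\beta,1)+1))}\bigr).$$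 In particular, for $\beta\ge1$ the rate is $n^{-1/4}$, and for $\beta\in(0,1]$ the rate is $n^{-\beta/(2(\beta+1))}$.
   Context: $\mathcal{H}=L^2([0,1])$ is the real separable Hilbert space with $\langle f,g\rangle=\int_0^1 f(u)g(u)\,du$ and norm $\|\cdot\|$; $\|\cdot\|_{\mathrm{op}}$ and $\|\cdot\|_{\mathrm{HS}}$ are the operator and Hilbert--Schmidt norms; $I$ is the identity on $\mathcal{H}$. The tensor product is $(f\otimes g)(h)=\langle g,h\rangle f$. When $\|\Psi\|_{\mathrm{op}}<1$, the FAR(1) equation has the unique stationary causal solution $X_t=\sum_{j\ge0}\Psi^j\varepsilon_{t-j}$, which has mean zero. $C_0^\beta$ is defined by the spectral calculus of the positive self-adjoint operator $C_0$. Sample operators: with $\bar X=n^{-1}\sum_{t=1}^nX_t$, $$\widehat{C}_0=\frac1n\sum_{t=1}^n(X_t-\bar X)\otimes(X_t-\bar X),\qquad \widehat{C}_1=\frac1{n-1}\sum_{t=1}^{n-1}(X_{t+1}-\bar X)\otimes(X_t-\bar X).$$ $L^4$-$m$-approximability (Hörmann--Kokoszka): $X_t$ has the form $X_t=f(\eta_t,\eta_{t-1},\dots)$ with $\{\eta_t\}$ i.i.d. in a measurable space and $f$ measurable into $\mathcal{H}$, $\mathbb{E}\|X_t\|^4<\infty$, and, setting $X_t^{(m)}=f(\eta_t,\dots,\eta_{t-m+1},\eta^{(t)}_{t-m},\eta^{(t)}_{t-m-1},\dots)$, where for each $t$ the sequence $\{\eta^{(t)}_k\}_k$ is an independent copy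 of $\{\eta_k\}_k$ (these copies being independent over $t$ and of the original sequence), so that $\{X_t^{(m)}\}_t$ is $m$-dependent, one has $\sum_{m=1}^\infty\bigl(\mathbb{E}\|X_t-X_t^{(m)}\|^4\bigr)^{1/4}<\infty$. $a_n\asymp b_n$ means that there are constants $0<c\le C<\infty$ with $cb_n\le a_n\le Cb_n$ for all $n$. $Y_n=O_P(r_n)$ means that $Y_n/r_n$ is bounded in probability (as $n\to\infty$). *)

(* Defs.v *)
From HB Require Import structures.
From mathcomp Require Import all_boot all_order all_algebra.
From mathcomp Require Import all_classical all_reals all_analysis.
From mathcomp Require Import measurable_realfun random_variable.

Set Implicit Arguments.
Unset Strict Implicit.
Unset Printing Implicit Defensive.
Import Order.TTheory GRing.Theory Num.Theory.
Import numFieldNormedType.Exports.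
Local Open Scope classical_set_scope.
Local Open Scope ring_scope.

HB.mixin Record NormedModule_isPreHilbert (R : realType) V
    & NormedModule R V := {
  inner : V -> V -> R;
  innerC : forall f g, inner f g = inner g f;
  innerDl : forall f g h, inner (f + g) h = inner f h + inner g h;
  innerZl : forall a f g, inner (a *: f) g = a * inner f g;
  innerff : forall f, inner f f = `|f| ^+ 2
}.

#[short(type="preHilbertType")]
HB.structure Definition PreHilbert (R : realType) :=
  {V of NormedModule R V & NormedModule_isPreHilbert R V}.

Section L2.
Context d (T : measurableType d) (R : realType).
Variable mu : {measure set T -> \bar R}.

(* The library's quotient type [LspaceType2 mu], which comes without algebraic
   structure, is equipped here with that of a pre-Hilbert space, transported
   from representatives. *)
Definition L2 : Type := LspaceType2 mu.
Local Notation L2fun := (LfunType mu (lee1n 2)).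
Local Notation mfunmu := {mfun_ mu, T >-> measurableTypeR R}.

HB.instance Definition _ := gen_eqMixin L2.
HB.instance Definition _ := gen_choiceMixin L2.

Let L2_mfun (f : L2) : mfunmu := LebesgueSpace.sort f.

Let L2_mfun_inj : injective L2_mfun.
Proof.
move=> [f [[Hf]]] [g [[Hg]]]; rewrite /L2_mfun /= => fg; subst g.
by rewrite (Prop_irrelevance Hf Hg).
Qed.

Lemma L2_repr_subproof (f : L2) : (repr (L2_mfun f) : T -> R) \in Lfun mu 2%:E.
Proof.
apply/andP; split; rewrite inE /=.
  by have := @measurable_funPT _ _ _ _ (repr (L2_mfun f)); exact.
by case: f => f [[Hf]].
Qed.
Definition L2_repr (f : L2) : L2fun := Lfun_Sub (lee1n 2) (L2_repr_subproof f).

Let L2fun_measurable (f : L2fun) : measurable_fun [set: T] (f : T -> measurableTypeR R).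
Proof. by have := @measurable_funPT _ _ _ _ f; exact. Qed.

Let mfun_of_L2fun (f : L2fun) : {mfun T >-> measurableTypeR R} :=
  @mfun_Sub _ _ T (measurableTypeR R) f (mem_set (L2fun_measurable f)).

Let mfunmu_class (f : L2fun) : mfunmu := \pi_(mfunmu)%qT (mfun_of_L2fun f).

Let mfunmu_classK (f : L2fun) : (repr (mfunmu_class f) : T -> R) = f %[ae mu].
Proof.
have : (repr (mfunmu_class f) == mfun_of_L2fun f %[mod mfunmu])%qT.
  by rewrite reprK.
by rewrite eqmodE => /asboolP.
Qed.

Let ae_eq_Lnorm2 (f g : T -> R) : measurable_fun setT f ->
  measurable_fun setT g -> f = g %[ae mu] ->
  ('N[mu]_2%:E[EFin \o f] = 'N[mu]_2%:E[EFin \o g])%E.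
Proof.
move=> mf mg fg; rewrite unlock /Lnorm; congr (_ `^ _)%E.
have mh (h : T -> R) : measurable_fun setT h ->
    measurable_fun setT (fun x => (`|(EFin \o h) x| `^ 2)%E).
  move=> ?; apply/measurable_EFinP; apply: (measurableT_comp (measurable_powR 2)).
  exact: measurableT_comp.
apply: ge0_ae_eq_integral => //; [exact: mh|exact: mh|..].
- by move=> x _; exact: poweR_ge0.
- by move=> x _; exact: poweR_ge0.
- by apply: filterS fg => x /(_ I) /= fx _; rewrite fx.
Qed.

Lemma L2_class_subproof (f : L2fun) : finite_norm mu 2%:E (mfunmu_class f).
Proof.
rewrite /finite_norm (@ae_eq_Lnorm2 _ f); [exact: Lfunction_finite|..].
- by have := @measurable_funPT _ _ _ _ (repr (mfunmu_class f)); exact.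
- exact: measurable_funPT.
- exact: mfunmu_classK.
Qed.

Definition L2_class (f : L2fun) : L2 :=
  LebesgueSpace.Pack (LebesgueSpace.Class
    (isFinLebesgue.Build _ _ _ mu _ (lee1n 2) _ (L2_class_subproof f))).

Lemma L2_classK (f : L2fun) : L2_repr (L2_class f) = f %[ae mu].
Proof. exact: mfunmu_classK. Qed.

Lemma L2_eqP (f g : L2) : (L2_repr f : T -> R) = L2_repr g %[ae mu] -> f = g.
Proof.
move=> fg; apply: L2_mfun_inj.
rewrite -[L2_mfun f]reprK -[RHS]reprK; apply/eqmodP; exact/asboolP.
Qed.

Let lfD (f g : L2fun) x : (f + g) x = f x + g x. Proof. by []. Qed.
Let lfN (f : L2fun) x : (- f) x = - f x. Proof. by []. Qed.
Let lfZ a (f : L2fun) x : (a *: f) x = a * f x. Proof. by []. Qed.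
Let lf0 x : (0 : L2fun) x = 0. Proof. by []. Qed.

Local Notation add := (fun f g : L2 => L2_class (L2_repr f + L2_repr g)).
Local Notation opp := (fun f : L2 => L2_class (- L2_repr f)).
Local Notation scale := (fun (a : R) (f : L2) => L2_class (a *: L2_repr f)).

Let addA : associative add.
Proof.
move=> f g h; apply: L2_eqP.
apply: filterS2 (filterI (L2_classK (L2_repr f + L2_repr (add g h)))
                         (L2_classK (L2_repr g + L2_repr h)))
  (filterI (L2_classK (L2_repr (add f g) + L2_repr h))
           (L2_classK (L2_repr f + L2_repr g))) => x [f_gh gh] [fg_h fg] _.
by rewrite f_gh// fg_h// !lfD gh// fg// !lfD addrA.
Qed.

Let addC : commutative add.
Proof. by move=> f g; rewrite /= addrC. Qed.

Let add0 : left_id (L2_class 0) add.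
Proof.
move=> f; apply: L2_eqP.
apply: filterS2 (L2_classK (L2_repr (L2_class 0) + L2_repr f)) (L2_classK 0)
  => x f0 z _.
by rewrite f0// lfD z// lf0 add0r.
Qed.

Let addN : left_inverse (L2_class 0) opp add.
Proof.
move=> f; apply: L2_eqP.
apply: filterS3 (L2_classK (L2_repr (opp f) + L2_repr f))
  (L2_classK (- L2_repr f)) (L2_classK 0) => x f0 nf z _.
by rewrite f0// z// lfD nf// lfN lf0 addNr.
Qed.

HB.instance Definition _ := GRing.isZmodule.Build L2 addA addC add0 addN.

Let scaleA a b (f : L2) : scale a (scale b f) = scale (a * b) f.
Proof.
apply: L2_eqP.
apply: filterS3 (L2_classK (a *: L2_repr (scale b f)))
  (L2_classK (b *: L2_repr f)) (L2_classK ((a * b) *: L2_repr f)) => x h1 h2 h3 _.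
by rewrite h1// h3// !lfZ h2// lfZ mulrA.
Qed.

Let scale1 (f : L2) : scale 1 f = f.
Proof.
apply: L2_eqP.
by have := L2_classK (1 *: L2_repr f); rewrite scale1r.
Qed.

Let scaleDr a : {morph scale a : f g / f + g}.
Proof.
move=> f g; apply: L2_eqP.
apply: filterS3 (filterI (L2_classK (a *: L2_repr (f + g)))
                         (L2_classK (L2_repr f + L2_repr g)))
  (filterI (L2_classK (a *: L2_repr f)) (L2_classK (a *: L2_repr g)))
  (L2_classK (L2_repr (scale a f) + L2_repr (scale a g)))
  => x [h1 h2] [h4 h5] h3 _.
by rewrite h1// h3// !(lfZ, lfD) h4// h5// h2// lfD !lfZ mulrDr.
Qed.

Let scaleDl (f : L2) a b : scale (a + b) f = scale a f + scale b f.
Proof.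
apply: L2_eqP.
apply: filterS2 (filterI (L2_classK ((a + b) *: L2_repr f))
                         (L2_classK (a *: L2_repr f)))
  (filterI (L2_classK (b *: L2_repr f))
           (L2_classK (L2_repr (scale a f) + L2_repr (scale b f))))
  => x [h1 h2] [h3 h4] _.
by rewrite h1// h4// lfD h2// h3// !lfZ mulrDl.
Qed.

HB.instance Definition _ := GRing.Zmodule_isLmodule.Build R L2
  scaleA scale1 scaleDr scaleDl.

Lemma L2_reprD (f g : L2) : L2_repr (f + g) = L2_repr f \+ L2_repr g %[ae mu].
Proof. exact: L2_classK. Qed.

Lemma L2_reprZ a (f : L2) : L2_repr (a *: f) = a \*: L2_repr f %[ae mu].
Proof. exact: L2_classK. Qed.

Lemma L2_repr0 : L2_repr 0 = cst 0 %[ae mu].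
Proof. exact: L2_classK. Qed.

Definition L2_norm (f : L2) : R := fine ('N[mu]_2%:E[EFin \o L2_repr f]).

Let L2_norm_ae (f : L2) (g : L2fun) : L2_repr f = g %[ae mu] ->
  L2_norm f = fine ('N[mu]_2%:E[EFin \o g]).
Proof. by move=> fg; congr fine; apply: ae_eq_Lnorm2. Qed.

Let L2_normD f g : L2_norm (f + g) <= L2_norm f + L2_norm g.
Proof.
rewrite (@L2_norm_ae _ (L2_repr f + L2_repr g)); first exact: ler_LnormD.
exact: L2_classK.
Qed.

Let L2_normZ a f : L2_norm (a *: f) = `|a| * L2_norm f.
Proof.
rewrite (@L2_norm_ae _ (a *: L2_repr f)); last exact: L2_classK.
by rewrite LnormZ fineM// -finite_norm_fine.
Qed.

Let L2_norm0 f : L2_norm f = 0 -> f = 0.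
Proof.
move=> /(@fine_Lnormr_eq0 _ _ _ mu _ (lee1n 2)) f0; apply: L2_eqP.
by apply: filterS2 f0 L2_repr0 => x f0 z xT; rewrite f0// z.
Qed.

HB.instance Definition _ := Lmodule_isNormed.Build R L2 L2_normD L2_normZ L2_norm0.

Definition L2_inner (f g : L2) : R := \int[mu]_x (L2_repr f x * L2_repr g x).

Let L2_inner_integrable (f g : L2) :
  mu.-integrable setT (EFin \o (fun x => L2_repr f x * L2_repr g x)).
Proof. by apply/Lfun1_integrable/Lfun2_mul_Lfun1; exact: LfunP. Qed.

Let ae_eq_L2_inner (f g : L2) (h : T -> R) : measurable_fun setT h ->
  (fun x => L2_repr f x * L2_repr g x) = h %[ae mu] ->
  L2_inner f g = \int[mu]_x h x.
Proof.
move=> mh fgh; congr fine; apply: ae_eq_integral => //.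
- exact: measurable_int (L2_inner_integrable f g).
- exact/measurable_EFinP.
- by apply: filterS fgh => x /(_ I) /= fx _; rewrite fx.
Qed.

Let L2_innerC f g : L2_inner f g = L2_inner g f.
Proof. by congr fine; apply: eq_integral => x _; rewrite mulrC. Qed.

Let L2_innerDl f g h : L2_inner (f + g) h = L2_inner f h + L2_inner g h.
Proof.
rewrite -RintegralD//; apply: ae_eq_L2_inner.
  apply: measurable_funD; exact: measurable_funM.
by apply: filterS (L2_reprD f g) => x h1 _; rewrite h1//= mulrDl.
Qed.

Let L2_innerZl a f g : L2_inner (a *: f) g = a * L2_inner f g.
Proof.
rewrite -RintegralZl//; apply: ae_eq_L2_inner.
  apply: measurable_funM => //; exact: measurable_funM.
by apply: filterS (L2_reprZ a f) => x h1 _; rewrite h1//= -mulrA.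
Qed.

Let L2_innerff f : L2_inner f f = `|f| ^+ 2.
Proof.
rewrite -(powR_mulrn 2 (normr_ge0 f)); apply: EFin_inj.
rewrite -poweR_EFin.
rewrite [X in (X `^ _)%E](_ : _ = 'N[mu]_2%:E[EFin \o L2_repr f])%E; last first.
  exact: finite_norm_fine (L2_repr f).
rewrite powR_Lnorm// /L2_inner /Rintegral fineK; last first.
  exact: integrable_fin_num (L2_inner_integrable f f).
apply: eq_integral => x _ /=; congr EFin.
by rewrite powR_mulrn// real_normK ?num_real// expr2.
Qed.

HB.instance Definition _ := NormedModule_isPreHilbert.Build R L2
  L2_innerC L2_innerDl L2_innerZl L2_innerff.

Lemma L2_normE f : `|f| = fine ('N[mu]_2%:E[EFin \o L2_repr f]).
Proof. by []. Qed.

Lemma L2_innerE f g : inner f g = \int[mu]_x (L2_repr f x * L2_repr g x).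
Proof. by []. Qed.

End L2.

(* L^2([0,1]), realised as the L^2 space of Lebesgue measure restricted to
   [0, 1] on the real line *)
Definition L2_01 (R : realType) : preHilbertType R :=
  L2 (mrestr (@lebesgue_measure R) (measurable_itv `[0%R, 1%R])).

Notation borel V := (g_sigma_algebraType (@open V)).

Section operators.
Context {R : realType} {V : preHilbertType R}.
Implicit Types (A B : V -> V) (e u v : nat -> V) (x : V).

Definition tensor (f g : V) : V -> V := fun h => inner g h *: f.

Definition bounded_operator A := linear A /\ continuous A.

Definition op_norm A : \bar R :=
  ereal_sup [set `|A x|%:E | x in [set x | `|x| <= 1]].

Definition orthonormal_seq e := forall i j, inner (e i) (e j) = (i == j)%:R.

Definition orthonormal_basis e := orthonormal_seq e /\
  forall x, series (fun k => inner (e k) x *: e k) @ \oo --> x.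

(* The value does not depend on the orthonormal basis; [xget] picks one.  For
   an unbounded linear map the sum alone means nothing, whence the boundedness
   required in [hilbert_schmidt]. *)
Definition hs_norm A : \bar R :=
  let e := xget (fun=> 0) orthonormal_basis in
  sqrte (\sum_(k <oo) (`|A (e k)| ^+ 2)%:E).

Definition hilbert_schmidt A := bounded_operator A /\ (hs_norm A < +oo)%E.

Definition compact_operator A :=
  linear A /\ compact (closure (A @` [set x | `|x| <= 1])).

(* absolutely summable singular values *)
Definition trace_class A := exists s u v,
  [/\ orthonormal_seq u, orthonormal_seq v, (forall k, 0 <= s k :> R),
      cvgn (series s) &
      forall x, series (fun k => s k *: tensor (u k) (v k) x) @ \oo --> A x].

(* [lam] lists the nonzero eigenvalues of the (compact, positive) operator [A]
   in decreasing order and with multiplicity, [e] being corresponding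
   orthonormal eigenvectors: the last clause says that no eigenvalue is missing
   and none is listed with too small a multiplicity. *)
Definition eigensystem A (lam : nat -> R) e :=
  [/\ orthonormal_seq e,
      (forall k, 0 < lam k),
      (forall k, lam k.+1 <= lam k),
      (forall k, A (e k) = lam k *: e k) &
      forall (r : R) x, r != 0 -> A x = r *: x ->
        (forall k, inner (e k) x = 0) -> x = 0].

(* [B] is A^beta in the sense of the spectral calculus, for a compact positive
   self-adjoint [A] and beta > 0 (so that the kernel of [A] contributes 0) *)
Definition is_operator_power A (beta : R) B := exists lam e,
  eigensystem A lam e /\
  forall x, series (fun k => lam k `^ beta *: tensor (e k) (e k) x) @ \oo --> B x.

Definition sample_mean (x : int -> V) (n : nat) : V :=
  n%:R^-1 *: \sum_(1 <= t < n.+1) x t%:Z.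

Definition sample_cov0 (x : int -> V) (n : nat) : V -> V :=
  n%:R^-1 *: \sum_(1 <= t < n.+1)
    tensor (x t%:Z - sample_mean x n) (x t%:Z - sample_mean x n).

Definition sample_cov1 (x : int -> V) (n : nat) : V -> V :=
  (n.-1)%:R^-1 *: \sum_(1 <= t < n)
    tensor (x t.+1%:Z - sample_mean x n) (x t%:Z - sample_mean x n).

(* ['pinv_(fun=> 0) setT f] is the inverse function of [f] when [f] is
   bijective *)
Definition far1_estimator (x : int -> V) (n : nat) (alpha : R) : V -> V :=
  sample_cov1 x n \o
    'pinv_(fun=> 0) setT (sample_cov0 x n + alpha *: (@idfun V)).

End operators.

Section probability.
Context d (Omega : measurableType d) (R : realType) (P : probability Omega R).

Section families.
Context d' (S : measurableType d').

Definition identically_distributed I (X : I -> Omega -> S) :=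
  forall i j B, measurable B -> P (X i @^-1` B) = P (X j @^-1` B).

Definition mutually_independent (I : eqType) (X : I -> Omega -> S) :=
  forall (s : seq I) (B : I -> set S), uniq s -> (forall i, measurable (B i)) ->
  P (\bigcap_(i in [set` s]) (X i @^-1` B i)) =
  (\prod_(i <- s) P (X i @^-1` B i))%E.

Definition iid (I : eqType) (X : I -> Omega -> S) :=
  [/\ forall i, measurable_fun setT (X i), identically_distributed X &
      mutually_independent X].

Definition strictly_stationary (X : int -> Omega -> S) :=
  forall (s : seq int) (h : int) (B : int -> set S),
  (forall t, measurable (B t)) ->
  P (\bigcap_(t in [set` s]) (X (t + h) @^-1` B t)) =
  P (\bigcap_(t in [set` s]) (X t @^-1` B t)).

End families.

(* Y_n = O_P(r_n): the outer measure [P^*] agrees with [P] on events and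
   dispenses with a measurability proof for Y_n. *)
Definition bigO_P (Y : nat -> Omega -> \bar R) (r : nat -> R) :=
  forall eps : R, 0 < eps -> exists2 M : R, 0 < M &
    \forall n \near \oo,
      ((P^*)%mu [set w | (M * r n)%:E < `|Y n w|] <= eps%:E)%E.

Context {V : preHilbertType R}.

(* The expectation of a random element of V with E||X|| finite is the m such
   that E<X, h> = <m, h> for every h; on separable Hilbert spaces this is the
   Bochner integral. *)
Definition is_expectation (X : Omega -> V) (m : V) :=
  P.-integrable setT (EFin \o (fun w => `|X w|)) /\
  forall h, ('E_P[fun w => inner (X w) h] = (inner m h)%:E)%E.

(* C = E[X (x) X] *)
Definition is_covariance_operator (X : Omega -> V) (C : V -> V) :=
  forall g, is_expectation (fun w => tensor (X w) (X w) g) (C g).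

Definition finite_moment4 (X : Omega -> V) : Prop :=
  ('E_P[fun w => (`|X w| ^+ 4)%R] < +oo)%E.

(* X is stationary, solves the FAR(1) equation and is the almost surely
   convergent sum of Psi^j eps_(t-j) over j >= 0. *)
Definition far1_causal_solution (Psi : V -> V) (eps X : int -> Omega -> V) :=
  [/\ forall t, measurable_fun setT (X t : Omega -> borel V),
      strictly_stationary (X : int -> Omega -> borel V),
      forall t, {ae P, forall w, X t w = Psi (X (t - 1) w) + eps t w} &
      forall t, {ae P, forall w,
        series (fun j : nat => iter j Psi (eps (t - j%:Z) w)) @ \oo --> X t w}].

End probability.

(* the product sigma-algebra on sequences in S is generated by these sets *)
Definition cylinders d (S : measurableType d) : set (set (nat -> S)) :=
  [set A | exists j B, measurable B /\ A = [set s | B (s j)]].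
Arguments cylinders {d} S.

(* The copies eta^(t) need room: they, and the coupled X_t^(m), live on an
   enlargement [proj : Omega' -> Omega] of the probability space. *)
Definition L4_m_approximable d (Omega : measurableType d) (R : realType)
    (P : probability Omega R) (V : preHilbertType R) (X : int -> Omega -> V) :=
  exists dS (S : measurableType dS) (eta : int -> Omega -> S)
    (f : (nat -> S) -> V)
    d' (Omega' : measurableType d') (P' : probability Omega' R)
    (proj : Omega' -> Omega) (eta' : int -> int -> Omega' -> S),
  let coupled m t w := f (fun j : nat =>
    if (j < m)%N then eta (t - j%:Z) (proj w) else eta' t (t - j%:Z) w) in
  [/\ measurable_fun setT (f : g_sigma_algebraType (cylinders S) -> borel V),
      iid P eta,
      forall t, {ae P, forall w, X t w = f (fun j : nat => eta (t - j%:Z) w)},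
      forall t, finite_moment4 P (X t) &
  [/\ measurable_fun setT proj,
      forall A, measurable A -> P' (proj @^-1` A) = P A,
      iid P' (fun i : int + int * int => match i with
                | inl k => eta k \o proj
                | inr (t, k) => eta' t k end) &
      forall t, (\sum_(1 <= m <oo)
        'E_P'[fun w => (`|X t (proj w) - coupled m t w| ^+ 4)%R] `^ 4^-1 < +oo)%E]].

Definition asymp (R : realType) (a b : nat -> R) :=
  exists c C : R, [/\ 0 < c, c <= C &
    forall n, (0 < n)%N -> c * b n <= a n <= C * b n].

(* Main.v *)
Require Import Defs.
From HB Require Import structures.
From mathcomp Require Import all_boot all_order all_algebra.
From mathcomp Require Import all_classical all_reals all_analysis.
From mathcomp Require Import measurable_realfun random_variable.
From mathcomp Require Import ring lra.
Set Implicit Arguments.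
Unset Strict Implicit.
Unset Printing Implicit Defensive.
Import Order.TTheory GRing.Theory Num.Theory.
Import numFieldNormedType.Exports.
Local Open Scope classical_set_scope.
Local Open Scope ring_scope.

(* Write C, S for the covariance operator and its sample version, T for the
   sample lag-one operator, R = (S + alpha I)^-1 and s = min(beta, 1).  The
   recursion gives (n - 1) T = n Psi S + N, where N collects the innovations
   and the terms due to centering; hence the estimation error is
     (n - 1)^-1 Psi S R + (n - 1)^-1 N R - alpha Psi R,
   a negligible term, a variance term of order n^-1/2 alpha^-1 and a bias
   term.  The latter is F (alpha C^beta R), and Bessel's inequality along the
   eigenvectors bounds alpha C^beta x by alpha^s (C + alpha) x up to a
   constant, with (C + alpha) R = I + (C - S) R.
   This leaves two facts: N has Hilbert-Schmidt norm O_P(n^1/2), and C - S is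
   O_P(n^-1/2).  For the second, the recursion shows that the bilinear form
   D = n (S - C), without the centering, satisfies D = Psi D Psi^* + remainder,
   so that the norm of D is at most 1 / (1 - q^2) times that of the remainder,
   q < 1 being the norm of Psi.  All the remainders are finitely many vectors
   bounded in probability and sums of martingale differences, whose second
   moments are O(n). *)

(** * Inner products and orthonormal bases *)

(** The structure [preHilbertType] carries no completeness, so a bounded functional need not have a
    Riesz representative and [Psi] need not have an adjoint. Wherever Psi^* g would occur, the
    truncations [riesz_sum b (inner g \o Psi)] stand in for it: they are bounded by q |g| and
    converge weakly, which suffices because only bilinear forms are iterated. Hilbert-Schmidt norms
    are expanded over a fixed basis into series of squared scalars. Exchanging integral and
    nonnegative series reduces their expectations to second moments of real martingale sums, without
    vector-valued conditional expectations. Probability enters through one event of small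
    probability, outside which all bounds are deterministic. The equation for D is the difference of
    the empirical recursion and the stationarity identity C = Psi C Psi^* + E[eps (x) eps]. The
    choice of alpha_n balances alpha^s against n^(-1/2) alpha^(-1); in particular the latter stays
    bounded, so (C - S) R affects the bias only by a constant factor. *)

Section inner_product.
Context {R : realType} {V : preHilbertType R}.
Implicit Types (x y g h : V) (e b : nat -> V).

Lemma inner_is_scalar x : scalar (inner x).
Proof. by move=> a y z; rewrite innerC innerDl innerZl !(innerC x). Qed.

HB.instance Definition _ x :=
  GRing.isLinear.Build R V R *%R (inner x) (inner_is_scalar x).

Lemma innerZr a x y : inner x (a *: y) = a * inner x y.
Proof. exact: linearZ. Qed.

Lemma innerBr x y z : inner x (y - z) = inner x y - inner x z.
Proof. exact: raddfB. Qed.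

Lemma innerBl x y z : inner (x - y) z = inner x z - inner y z.
Proof. by rewrite !(innerC _ z) innerBr. Qed.

Lemma cauchy_schwarz x y : `|inner x y| <= `|x| * `|y|.
Proof.
have [->|y0] := eqVneq y 0; first by rewrite raddf0 !normr0 mulr0.
have ny : 0 < `|y| by rewrite normr_gt0.
have : 0 <= inner (`|y| ^+ 2 *: x - inner x y *: y) (`|y| ^+ 2 *: x - inner x y *: y).
  by rewrite innerff exprn_ge0.
rewrite !(innerBr, innerBl).
rewrite !innerZl !innerZr !innerff (innerC y x) => h.
have {}h : 0 <= `|y| ^+ 2 * ((`|x| * `|y|) ^+ 2 - inner x y ^+ 2) by nra.
rewrite pmulr_rge0 ?exprn_gt0// subr_ge0 in h.
by rewrite -ler_sqr ?nnegrE ?mulr_ge0// real_normK ?num_real.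
Qed.

Lemma bounded_additive_continuous (W : normedModType R) (f : {additive V -> W}) (K : R) :
  (forall x, `|f x| <= K * `|x|) -> continuous f.
Proof.
move=> fK x; apply/cvgrPdist_le => e e0.
have [K0|K0] := leP K 0.
  by near=> y; rewrite -raddfB (le_trans (fK _))// (le_trans _ (ltW e0))// mulr_le0_ge0.
near=> y; rewrite -raddfB (le_trans (fK _))//.
rewrite -ler_pdivlMl//; near: y.
apply: cvgr_dist_le; first exact: cvg_id.
by apply: mulr_gt0 => //; rewrite invr_gt0.
Unshelve. all: by end_near. Qed.

Lemma inner_continuous x : continuous (inner x).
Proof. exact: (bounded_additive_continuous (f := inner x) (cauchy_schwarz x)). Qed.

Lemma cvg_inner (u : nat -> V) x y : u @ \oo --> x ->
  inner y (u n) @[n --> \oo] --> inner y x.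
Proof. by move=> ux; apply: continuous_cvg => //; exact: inner_continuous. Qed.

Lemma sqr_normD x y : `|x + y| ^+ 2 = `|x| ^+ 2 + 2 * inner x y + `|y| ^+ 2.
Proof. by rewrite -!innerff innerDl !(innerC _ (x + y)) !innerDl (innerC y x); ring. Qed.

Lemma sqr_norm_sum e (c : nat -> R) n : orthonormal_seq e ->
  `|\sum_(0 <= k < n) c k *: e k| ^+ 2 = \sum_(0 <= k < n) c k ^+ 2.
Proof.
move=> eo; elim: n => [|n IH]; first by rewrite !big_nil normr0 expr0n.
rewrite !big_nat_recr//= sqr_normD IH innerC linear_sum/=.
have -> : \sum_(0 <= i < n) inner (c n *: e n) (c i *: e i) = 0.
  apply: big1_seq => k /=; rewrite mem_index_iota innerZl innerZr eo => kn.
  by case: eqP kn => [<-|_ _]; rewrite ?ltnn// !mulr0.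
by rewrite mulr0 addr0 -innerff innerZl innerZr eo eqxx mulr1 expr2.
Qed.

Lemma bessel e x n : orthonormal_seq e ->
  \sum_(0 <= k < n) inner (e k) x ^+ 2 <= `|x| ^+ 2.
Proof.
move=> eo; set s := \sum_(0 <= k < n) _.
pose y := \sum_(0 <= k < n) inner (e k) x *: e k.
have yx : inner x y = s.
  by rewrite linear_sum/=; apply: eq_bigr => k _; rewrite innerZr innerC -expr2.
have := exprn_ge0 2 (normr_ge0 (x - y)).
rewrite -innerff innerBl !innerBr (innerC y x) yx !innerff sqr_norm_sum//.
rewrite -/s; lra.
Qed.

Lemma cvg_nneseries_fin (u : nat -> R) (l : R) : series u @ \oo --> l ->
  (\sum_(k <oo) (u k)%:E = l%:E)%E.
Proof.
move=> ul; apply/cvg_lim => //; apply: cvg_EFin.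
  by near=> n; rewrite sumEFin.
by apply: cvg_trans ul; apply: near_eq_cvg; near=> n; rewrite /= sumEFin.
Unshelve. all: by end_near. Qed.

Lemma parseval b x : orthonormal_basis b ->
  (\sum_(k <oo) (inner (b k) x ^+ 2)%:E = (`|x| ^+ 2)%:E)%E.
Proof.
move=> [bo bx]; apply: cvg_nneseries_fin.
have : `|series (fun k => inner (b k) x *: b k) n| ^+ 2 @[n --> \oo] --> `|x| ^+ 2.
  by under eq_fun do rewrite expr2; rewrite expr2; apply: cvgM; apply: cvg_norm; exact: bx.
apply: cvg_trans; apply: near_eq_cvg; near=> n.
by rewrite /series/= sqr_norm_sum.
Unshelve. all: by end_near. Qed.

(* The coordinate truncations of the Riesz representative of [phi]; without
   completeness of [V] they need not converge in norm, but they do weakly. *)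
Definition riesz_sum b (phi : V -> R) n := \sum_(0 <= j < n) phi (b j) *: b j.

Lemma cvg_riesz_sum b (phi : {scalar V}) x : orthonormal_basis b ->
  continuous phi -> inner x (riesz_sum b phi n) @[n --> \oo] --> phi x.
Proof.
move=> [_ bx] cphi.
have : phi (series (fun k => inner (b k) x *: b k) n) @[n --> \oo] --> phi x.
  by apply: continuous_cvg; [exact: cphi|exact: bx].
apply: cvg_trans; apply: near_eq_cvg; near=> n.
rewrite /series/= /riesz_sum !linear_sum/=; apply: eq_bigr => k _.
by rewrite scalarZ innerZr mulrC (innerC x).
Unshelve. all: by end_near. Qed.

(** On its own truncation y the functional takes the value |y|^2, so that the bound at y reads |y|^2
    <= K |y|. *)
Lemma norm_riesz_sum b (phi : {scalar V}) K n : orthonormal_seq b -> 0 <= K ->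
  (forall x, `|phi x| <= K * `|x|) -> `|riesz_sum b phi n| <= K.
Proof.
move=> bo K0 phiK; set y := riesz_sum b phi n.
have [->|y0] := eqVneq y 0; first by rewrite normr0.
have yy : phi y = `|y| ^+ 2.
  by rewrite sqr_norm_sum// linear_sum/=; apply: eq_bigr => k _; rewrite scalarZ expr2.
have := phiK y; rewrite yy ger0_norm ?exprn_ge0// expr2 ler_pM2r//.
by rewrite normr_gt0.
Qed.

(** Cauchy-Schwarz against each truncation of the Riesz representative, whose squared norm is a
    partial sum of the series, followed by the weak limit. If the series is infinite, the bound is
    trivial for x <> 0. *)
Lemma scalar_le_nneseries b (phi : {scalar V}) x : orthonormal_basis b ->
  continuous phi ->
  ((phi x ^+ 2)%:E <= (\sum_(k <oo) (phi (b k) ^+ 2)%:E) * (`|x| ^+ 2)%:E)%E.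
Proof.
move=> bb cphi; set m := (\sum_(k <oo) _)%E.
have m0 : (0 <= m)%E by apply: nneseries_ge0 => k _ _; rewrite lee_fin sqr_ge0.
have [->|x0] := eqVneq x 0; first by rewrite raddf0 normr0 !expr0n/= mule0.
have nx : 0 < `|x| ^+ 2 by rewrite exprn_gt0// normr_gt0.
case mE : m m0 => [r| |//] r0; last by rewrite gt0_mulye ?leey// lte_fin.
rewrite -EFinM lee_fin.
have : (inner x (riesz_sum b phi n)) ^+ 2 @[n --> \oo] --> phi x ^+ 2.
  under eq_fun do rewrite expr2; rewrite expr2.
  by apply: cvgM; exact: cvg_riesz_sum.
move/(@cvg_lim _ _); move=> <- //; apply: limr_le.
  apply/cvg_ex; exists (phi x ^+ 2).
  under eq_fun do rewrite expr2; rewrite expr2.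
  by apply: cvgM; exact: cvg_riesz_sum.
near=> n; rewrite -real_normK ?num_real//.
apply: (@le_trans _ _ ((`|x| * `|riesz_sum b phi n|) ^+ 2)).
  by rewrite lerXn2r ?nnegrE ?mulr_ge0// cauchy_schwarz.
rewrite exprMn mulrC ler_wpM2r ?exprn_ge0// sqr_norm_sum; last by case: bb.
rewrite -lee_fin -mE -sumEFin; apply: nneseries_lim_ge => k _ _.
by rewrite lee_fin sqr_ge0.
Unshelve. all: by end_near. Qed.

(** Converse of the previous bound: a partial sum of the series is |y|^2 = phi y, where y is the
    truncation along the orthonormal sequence. *)
Lemma nneseries_le_scalar e (phi : {scalar V}) M : orthonormal_seq e -> 0 <= M ->
  (forall x, phi x ^+ 2 <= M * `|x| ^+ 2) ->
  (\sum_(k <oo) (phi (e k) ^+ 2)%:E <= M%:E)%E.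
Proof.
move=> eo M0 phiM; apply: lime_le.
  by apply: is_cvg_nneseries => k _ _; rewrite lee_fin sqr_ge0.
near=> n; rewrite sumEFin lee_fin.
set y := riesz_sum e phi n.
have yy : phi y = `|y| ^+ 2.
  by rewrite sqr_norm_sum// linear_sum/=; apply: eq_bigr => k _; rewrite scalarZ expr2.
rewrite -(sqr_norm_sum _ _ eo) -/(riesz_sum e phi n) -/y.
have := phiM y; rewrite yy.
have [->|y0] := eqVneq y 0; first by rewrite normr0 expr0n.
by rewrite [X in X <= _]expr2 ler_pM2r// exprn_gt0// normr_gt0.
Unshelve. all: by end_near. Qed.

(** Squared Hilbert-Schmidt norm relative to a prescribed basis; being an extended real, it can be
    estimated before it is known to be finite. *)
Definition hs2 b (A : V -> V) : \bar R := (\sum_(k <oo) (`|A (b k)| ^+ 2)%:E)%E.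

(** Without adjoints the argument goes row by row. Parseval and an exchange of sums produce the
    coefficients of the functionals <b_l, A .>; their square sum M bounds the squared norm of the
    functional, composition with B costs K^2, and [nneseries_le_scalar] returns to a square sum. *)
Lemma hs2_comp b (A B : {linear V -> V}) K : orthonormal_basis b ->
  continuous A -> 0 < K -> (forall x, `|B x| <= K * `|x|) ->
  (hs2 b (A \o B) <= (K ^+ 2)%:E * hs2 b A)%E.
Proof.
move=> bb cA K0 BK; have [bo _] := bb; rewrite /hs2.
have sq0 (r : R) : (0 <= (r ^+ 2)%:E)%E by rewrite lee_fin sqr_ge0.
under eq_eseriesr do rewrite -(parseval _ bb).
under [in leRHS]eq_eseriesr do rewrite -(parseval _ bb).
rewrite nneseries_interchange//.
rewrite [in leRHS]nneseries_interchange//.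
rewrite -nneseriesZl; last by move=> i _; apply: nneseries_ge0.
apply: lee_nneseries => [l _ _|l _]; first exact: nneseries_ge0.
set M := (X in (_ <= _ * X)%E).
have M0 : (0 <= M)%E by exact: nneseries_ge0.
have cphi : continuous (inner (b l) \o A).
  by move=> x; apply: continuous_comp; [exact: cA|exact: inner_continuous].
case rE : M M0 => [r| |//]; last first.
  by rewrite gt0_muley ?leey// lte_fin exprn_gt0.
rewrite [in X in X -> _]lee_fin => r0; rewrite -EFinM.
apply: (nneseries_le_scalar (phi := inner (b l) \o A \o B)) => //.
  by rewrite mulr_ge0// exprn_ge0// ltW.
move=> x; rewrite -lee_fin/=.
apply: (le_trans (scalar_le_nneseries (phi := inner (b l) \o A) (B x) bb cphi)).
rewrite -[X in (X * _)%E]/M rE -EFinM lee_fin mulrAC mulrC ler_wpM2r//.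
by rewrite -exprMn lerXn2r ?nnegrE ?mulr_ge0// ltW.
Qed.

End inner_product.

(** * Ridge inverses *)

Section bounded_maps.
Context {R : realType} {V : preHilbertType R}.
Implicit Types (x y g h : V) (e b : nat -> V).

Lemma norm_le_inner x (K : R) : 0 <= K ->
  (forall h, `|inner x h| <= K * `|h|) -> `|x| <= K.
Proof.
move=> K0 xK; have [->|x0] := eqVneq x 0; first by rewrite normr0.
have := xK x; rewrite innerff ger0_norm ?exprn_ge0// expr2 ler_pM2r//.
by rewrite normr_gt0.
Qed.

Lemma tensor_is_linear (f g : V) : linear (tensor f g).
Proof.
by move=> a x y; rewrite /tensor (linearP (inner g)) scalerDl scalerA.
Qed.

HB.instance Definition _ f g :=
  GRing.isLinear.Build R V V *:%R (tensor f g) (tensor_is_linear f g).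

(** A finite rank operator plus alpha I; the vectors form a list so that induction on the rank is
    possible. *)
Definition ridge (s : seq V) (c alpha : R) x :=
  c *: (\sum_(u <- s) inner u x *: u) + alpha *: x.

Lemma ridge_is_linear s c alpha : linear (ridge s c alpha).
Proof.
move=> a x y; rewrite /ridge scalerDr scalerDr addrACA; congr (_ + _); last first.
  by congr (_ + _); rewrite !scalerA mulrC.
rewrite scalerA mulrC -scalerA -scalerDr; congr (_ *: _).
rewrite scaler_sumr -big_split/=; apply: eq_bigr => u _.
by rewrite (linearP (inner u)) scalerDl scalerA.
Qed.

HB.instance Definition _ s c alpha :=
  GRing.isLinear.Build R V V *:%R (ridge s c alpha) (ridge_is_linear s c alpha).

Lemma ridge_ge s c alpha x : 0 <= c ->
  alpha * `|x| ^+ 2 <= inner x (ridge s c alpha x).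
Proof.
move=> c0; rewrite /ridge raddfD/= !innerZr innerff lerDr mulr_ge0//.
rewrite linear_sum/= sumr_ge0// => u _.
by rewrite innerZr (innerC x) -expr2 sqr_ge0.
Qed.

Lemma ridge_cons u s c alpha x :
  ridge (u :: s) c alpha x = ridge s c alpha x + (c * inner u x) *: u.
Proof. by rewrite /ridge big_cons scalerDr scalerA -addrA addrC. Qed.

(* Induction on the rank, by the Sherman-Morrison formula. *)
Lemma ridge_surj s c alpha y : 0 <= c -> 0 < alpha ->
  exists x, ridge s c alpha x = y.
Proof.
move=> c0 a0; elim: s y => [|u s IH] y.
  exists (alpha^-1 *: y).
  by rewrite /ridge big_nil scaler0 add0r scalerA divff ?gt_eqF// scale1r.
have [x0 Tx0] := IH y; have [x1 Tx1] := IH u.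
have ux1 : 0 <= inner u x1.
  rewrite -Tx1 innerC; apply: le_trans (ridge_ge _ _ _ c0).
  by rewrite mulr_ge0 ?exprn_ge0// ltW.
have den : 1 + c * inner u x1 != 0 by rewrite gt_eqF// ltr_pwDl// mulr_ge0.
pose r := c * inner u x0 / (1 + c * inner u x1).
exists (x0 - r *: x1); rewrite ridge_cons linearB linearZ/= Tx0 Tx1.
rewrite innerBr innerZr -addrA -scaleNr -scalerDl -[RHS]addr0; congr (_ + _).
rewrite [X in X *: _](_ : _ = 0) ?scale0r//.
by rewrite /r; field.
Qed.

(** Coercivity [ridge_ge] played against Cauchy-Schwarz; injectivity follows. *)
Lemma ridge_norm s c alpha x : 0 <= c -> 0 < alpha ->
  `|x| <= alpha^-1 * `|ridge s c alpha x|.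
Proof.
move=> c0 a0; have [->|x0] := eqVneq x 0.
  by rewrite normr0 mulr_ge0// invr_ge0 ltW.
rewrite ler_pdivlMl// -(ler_pM2l (_ : 0 < `|x|)) ?normr_gt0//.
rewrite mulrCA -expr2 (le_trans (ridge_ge s _ x c0))//.
by rewrite (le_trans (ler_norm _))// cauchy_schwarz.
Qed.

Lemma ridge_inj s c alpha : 0 <= c -> 0 < alpha -> injective (ridge s c alpha).
Proof.
move=> c0 a0 x y xy; apply/eqP; rewrite -subr_eq0 -normr_le0.
by rewrite (le_trans (ridge_norm s _ c0 a0))// linearB/= xy subrr normr0 mulr0.
Qed.

(** [pinv] merely selects preimages. Surjectivity makes it a right inverse, and injectivity of
    [ridge] then transports linearity to it. *)
Lemma ridge_pinv s c alpha : 0 <= c -> 0 < alpha ->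
  exists B : {linear V -> V}, [/\ 'pinv_(fun=> 0) setT (ridge s c alpha) = B,
    (forall y, ridge s c alpha (B y) = y) &
    (forall y, `|B y| <= alpha^-1 * `|y|)].
Proof.
move=> c0 a0; set T := ridge s c alpha; set B0 := 'pinv_(fun=> 0) setT T.
have TB y : T (B0 y) = y.
  have [x <-] := ridge_surj s y c0 a0.
  by apply: pinvK; rewrite inE; exists x.
have linB : linear B0.
  move=> a x y; apply: (@ridge_inj s c alpha) => //; apply: etrans (TB _) _.
  apply/esym; apply: etrans (linearP (ridge s c alpha) _ _ _) _.
  by congr (_ *: _ + _); exact: TB.
pose B : {linear V -> V} := HB.pack B0 (GRing.isLinear.Build R V V *:%R B0 linB).
exists B; split => // y.
by rewrite (le_trans (ridge_norm s _ c0 a0))// -/T TB.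
Qed.

End bounded_maps.

(** * Source condition *)

Section source_condition.
Context {R : realType} {V : preHilbertType R}.
Implicit Types (x y g h : V) (e b : nat -> V).

Lemma le_of_sqr (u v : R) : 0 <= v -> u ^+ 2 <= v ^+ 2 -> u <= v.
Proof. by move=> v0 uv; rewrite leNgt; apply/negP => vu; nra. Qed.

(** After splitting with exponents s and 1 - s and removing the common factor alpha^s, it remains to
    multiply l^s <= (l + alpha)^s and alpha^(1-s) <= (l + alpha)^(1-s). *)
Lemma tikhonov_filter_le (l alpha s : R) : 0 <= l -> 0 < alpha -> 0 <= s <= 1 ->
  alpha * l `^ s <= alpha `^ s * (l + alpha).
Proof.
move=> l0 a0 /andP[s0 s1].
have la : 0 < l + alpha by rewrite ltr_wpDl.
have E (r : R) : 0 < r -> r = r `^ s * r `^ (1 - s).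
  move=> r0; rewrite -powRD ?(gt_eqF r0) ?implybT//.
  by rewrite (_ : s + (1 - s) = 1); last ring; rewrite powRr1// ltW.
rewrite {1}(E _ a0) (E _ la) -mulrA ler_wpM2l ?powR_ge0// mulrC.
have [a1 la1 s2] : [/\ 0 <= alpha, 0 <= l + alpha & 0 <= 1 - s].
  by rewrite subr_ge0; split => //; exact: ltW.
apply: ler_pM; rewrite ?powR_ge0// ge0_ler_powR ?nnegrE//; first by rewrite lerDl.
by rewrite lerDr.
Qed.

(** Ridge regularisation saturates at exponent 1: the excess power beta - min(beta, 1) of l is
    absorbed into the constant through l <= L and gains nothing in alpha. *)
Lemma tikhonov_qualification (l L alpha beta : R) : 0 < l -> l <= L ->
  0 < alpha -> 0 < beta ->
  alpha * l `^ beta <=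
    L `^ (beta - Num.min beta 1) * alpha `^ Num.min beta 1 * (l + alpha).
Proof.
move=> l0 lL a0 beta0; set s := Num.min beta 1.
have s01 : 0 <= s <= 1 by rewrite /s le_min ge_min lexx orbT ler01 (ltW beta0).
have sb : 0 <= beta - s by rewrite subr_ge0 ge_min lexx.
have -> : l `^ beta = l `^ (beta - s) * l `^ s.
  by rewrite -powRD ?(gt_eqF l0) ?implybT// subrK.
rewrite mulrCA -mulrA; apply: ler_pM; rewrite ?powR_ge0//.
- by rewrite mulr_ge0 ?powR_ge0// ltW.
- by rewrite ge0_ler_powR ?nnegrE// ltW// (lt_le_trans l0).
by apply: tikhonov_filter_le => //; exact: ltW.
Qed.

(** By symmetry of [C] the k-th coordinate of z is lam k + alpha times that of x, and [lam 0]
    dominates all eigenvalues, so the scalar inequality holds in each coordinate with the same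
    constant. *)
Lemma operator_power_bound (C C' : V -> V) lam e (alpha beta : R) x z :
  (forall g h, inner (C g) h = inner g (C h)) -> eigensystem C lam e ->
  0 < alpha -> 0 < beta ->
  (series (fun k => lam k `^ beta *: tensor (e k) (e k) x) @ \oo --> C' x) ->
  C x + alpha *: x = z ->
  alpha * `|C' x| <=
    lam 0%N `^ (beta - Num.min beta 1) * alpha `^ Num.min beta 1 * `|z|.
Proof.
move=> Csym [eo lam0 lamS lamE _] a0 b0 C'x Cxz.
set K := _ * alpha `^ _.
have K0 : 0 <= K by rewrite mulr_ge0 ?powR_ge0.
have lamL k : lam k <= lam 0%N by elim: k => // k; exact: le_trans.
have ez k : inner (e k) z = (lam k + alpha) * inner (e k) x.
  by rewrite -Cxz raddfD/= -Csym lamE innerZl innerZr mulrDl.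
have : alpha * `|series (fun k => lam k `^ beta *: tensor (e k) (e k) x) n|
    @[n --> \oo] --> alpha * `|C' x|.
  by apply: cvgM; [exact: cvg_cst|exact: cvg_norm].
move=> lim; rewrite -(cvg_lim _ lim)//; apply: limr_le; first by apply/cvg_ex; eexists; exact: lim.
near=> n.
apply: le_of_sqr; first exact: mulr_ge0.
rewrite [leLHS]exprMn [leRHS]exprMn /series/=.
under eq_bigr do rewrite /tensor scalerA.
rewrite (sqr_norm_sum _ _ eo) mulr_sumr.
apply: (@le_trans _ _ (K ^+ 2 * \sum_(0 <= k < n) inner (e k) z ^+ 2)).
  rewrite mulr_sumr; apply: ler_sum => k _.
  rewrite ez -!exprMn !mulrA !(exprMn _ _ (inner (e k) x)) ler_wpM2r ?sqr_ge0//.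
  rewrite lerXn2r ?nnegrE ?mulr_ge0 ?powR_ge0 ?addr_ge0 ?(ltW a0) ?(ltW (lam0 _))//.
  exact: tikhonov_qualification.
by rewrite ler_wpM2l ?sqr_ge0// bessel.
Unshelve. all: by end_near. Qed.

End source_condition.

(** * Deviation of the sample covariance *)

Section covariance_recursion.
Context {R : realType} {V : preHilbertType R}.
Implicit Types (g h : V).

Lemma cvgn_le (u : nat -> R) (l B : R) :
  u @ \oo --> l -> (forall n, u n <= B) -> l <= B.
Proof.
move=> ul uB; rewrite -(cvg_lim _ ul)//; apply: limr_le.
  by apply/cvg_ex; exists l.
by near=> n; exact: uB.
Unshelve. all: by end_near. Qed.

Lemma cvgn_norm_le (u : nat -> R) (l B : R) :
  u @ \oo --> l -> (forall n, `|u n| <= B) -> `|l| <= B.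
Proof.
move=> ul; apply: cvgn_le; exact: cvg_norm.
Qed.

Lemma cvgn_sum I (s : seq I) (u : I -> nat -> R) (l : I -> R) :
  (forall i, u i @ \oo --> l i) ->
  \sum_(i <- s) u i n @[n --> \oo] --> \sum_(i <- s) l i.
Proof.
move=> ul; elim: s => [|i s IH].
  under eq_fun do rewrite big_nil.
  by rewrite big_nil; exact: cvg_cst.
under eq_fun do rewrite big_cons.
by rewrite big_cons; apply: cvgD.
Qed.

(** [K] is an a priori bound whose weight Q^k vanishes in the limit, leaving the sum r / (1 - Q) of
    the geometric series. *)
Lemma contraction_bound (Q r K M u : R) : 0 <= Q < 1 ->
  (forall k : nat, u <= (Q ^+ k * K + r / (1 - Q)) * M) -> u <= r / (1 - Q) * M.
Proof.
move=> /andP[Q0 Q1] uk.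
have lim : u - (Q ^+ k * K + r / (1 - Q)) * M @[k --> \oo] -->
    u - (0 * K + r / (1 - Q)) * M.
  apply: cvgB; first exact: cvg_cst.
  apply: cvgM; last exact: cvg_cst.
  apply: cvgD; last exact: cvg_cst.
  apply: cvgM; last exact: cvg_cst.
  by apply: cvg_expr; rewrite ger0_norm.
rewrite -subr_le0; move: lim; rewrite mul0r add0r => /cvgn_le; apply => k.
by rewrite subr_le0.
Qed.

Context (b : nat -> V) (Psi C0 : {linear V -> V}) (q : R) (cc : V -> V -> R).
Hypothesis bb : orthonormal_basis b.
Hypothesis q01 : 0 <= q < 1.
Hypothesis Psiq : forall x, `|Psi x| <= q * `|x|.
Lemma norm_riesz_sum_comp g J : `|riesz_sum b (inner g \o Psi) J| <= q * `|g|.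
Proof.
have [q0 _] := andP q01; have [bo _] := bb.
apply: (norm_riesz_sum (phi := inner g \o Psi)) => // [|y /=]; first exact: mulr_ge0.
rewrite (le_trans (cauchy_schwarz _ _))// [q * _]mulrC -mulrA.
by rewrite ler_wpM2l.
Qed.

Lemma cvg_riesz_sum_comp g y :
  inner y (riesz_sum b (inner g \o Psi) J) @[J --> \oo] --> inner g (Psi y).
Proof.
apply: (cvg_riesz_sum (phi := inner g \o Psi)) => //.
apply: (bounded_additive_continuous (f := inner g \o Psi) (K := `|g| * q)) => z /=.
by rewrite (le_trans (cauchy_schwarz _ _))// -mulrA ler_wpM2l.
Qed.

(** Weak form of the stationarity identity: C0 equals Psi C0 Psi^* plus the innovation covariance,
    whose bilinear form is [cc]. *)
Hypothesis C0_lim : forall g h,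
  inner (C0 (riesz_sum b (inner g \o Psi) J)) (riesz_sum b (inner h \o Psi) J)
    @[J --> \oo] --> inner (C0 g) h - cc g h.

Context (n : nat) (x eps : nat -> V) (K w gam tau : R).
Hypothesis n0 : (0 < n)%N.
Hypotheses (K0 : 0 <= K) (w0 : 0 <= w) (gam0 : 0 <= gam) (tau0 : 0 <= tau).
Hypothesis x_rec : forall t, (0 < t < n)%N -> x t.+1 = Psi (x t) + eps t.+1.
Hypothesis C0K : forall g, `|C0 g| <= K * `|g|.
Hypothesis cc_le : forall g h, `|cc g h| <= tau * `|g| * `|h|.
Hypothesis W_le : forall g h,
  `|\sum_(1 <= t < n) (inner (eps t.+1) g * inner (eps t.+1) h - cc g h)| <=
  w * `|g| * `|h|.
Hypothesis G_le : forall g h,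
  `|inner (\sum_(1 <= t < n) tensor (eps t.+1) (x t) g) h| <= gam * `|g| * `|h|.

Let D g h :=
  \sum_(1 <= t < n.+1) inner (x t) g * inner (x t) h - n%:R * inner (C0 g) h.

Let r := w + gam * q *+ 2 + `|x 1%N| ^+ 2 + (q * `|x n|) ^+ 2 + tau.

Let Riesz g := riesz_sum b (inner g \o Psi).

Let M g h := \sum_(1 <= t < n) inner g (Psi (x t)) * inner (eps t.+1) h.

(** [M g h] is the cross form bounded by [G_le], taken at Psi^* g in place of g; the truncations
    supply the factor q. *)
Let M_le g h : `|M g h| <= gam * q * `|g| * `|h|.
Proof.
apply: (@cvgn_norm_le (fun J => inner (\sum_(1 <= t < n) tensor (eps t.+1) (x t) (Riesz g J)) h)).
  under eq_fun => J do rewrite innerC linear_sum/=.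
  rewrite /M; apply: (cvgn_sum (u := fun t J => _)) => t.
  under eq_fun => J do rewrite innerZr (innerC h).
  by apply: cvgM; [exact: cvg_riesz_sum_comp|exact: cvg_cst].
move=> J; rewrite (le_trans (G_le _ _))// ler_wpM2r//.
by rewrite -mulrA ler_wpM2l// norm_riesz_sum_comp.
Qed.

(** The value of [D] at the pair Psi^* g, Psi^* h, where the form of [C0] becomes
    [inner (C0 g) h - cc g h]. *)
Let D' g h := \sum_(1 <= t < n.+1) inner g (Psi (x t)) * inner h (Psi (x t)) -
  n%:R * (inner (C0 g) h - cc g h).

(** Shifting the sum by one splits off x_1, and the recursion turns every later x_(t+1) into Psi x_t
    + eps_(t+1). [D'] contains Psi x_n in excess, and its n copies of [cc] meet only n - 1
    innovations, whence the last term. *)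
Let DE g h : D g h = D' g h + (inner (x 1%N) g * inner (x 1%N) h -
  inner g (Psi (x n)) * inner h (Psi (x n)) + (M g h + M h g) +
  \sum_(1 <= t < n) (inner (eps t.+1) g * inner (eps t.+1) h - cc g h) - cc g h).
Proof.
rewrite /D /D' big_ltn// big_add1/= [in RHS]big_nat_recr//= sumrB.
rewrite sumr_const_nat subn1 -[cc g h *+ _]mulr_natl.
have -> : n%:R = n.-1%:R + 1 :> R by rewrite -[in LHS](prednK n0) -natr1.
have -> : \sum_(1 <= t < n) inner (x t.+1) g * inner (x t.+1) h =
    \sum_(1 <= t < n) inner g (Psi (x t)) * inner h (Psi (x t)) + (M g h + M h g) +
    \sum_(1 <= t < n) inner (eps t.+1) g * inner (eps t.+1) h.
  rewrite /M -!big_split/=; apply: eq_big_nat => t tn.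
  by rewrite x_rec// !innerDl !(innerC (Psi _)); ring.
by ring.
Qed.

(* Psi has an adjoint only in the weak sense of [cvg_riesz_sum_comp], so that
   D(Psi^* g, Psi^* h) is reached as a limit. *)
Let D_step s : 0 <= s -> (forall g h, `|D g h| <= s * (`|g| * `|h|)) ->
  forall g h, `|D g h| <= (q ^+ 2 * s + r) * (`|g| * `|h|).
Proof.
move=> s0 Ds g h; rewrite DE mulrDl (le_trans (ler_normD _ _))// lerD//.
  apply: (@cvgn_norm_le (fun J => D (Riesz g J) (Riesz h J))).
    apply: cvgB; last by apply: cvgM; [exact: cvg_cst|exact: C0_lim].
    by apply: (cvgn_sum (u := fun t J => _)) => t; apply: cvgM; exact: cvg_riesz_sum_comp.
  move=> J; rewrite (le_trans (Ds _ _))// [q ^+ 2 * s]mulrC -mulrA ler_wpM2l//.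
  by rewrite expr2 mulrACA ler_pM//; exact: norm_riesz_sum_comp.
have CS (y z1 z2 : V) (k : R) : `|y| <= k -> `|inner y z1 * inner y z2| <= k ^+ 2 * (`|z1| * `|z2|).
  move=> yk; rewrite normrM expr2 mulrACA.
  apply: ler_pM => //; rewrite (le_trans (cauchy_schwarz _ _))// ler_wpM2r//.
have := CS (x 1%N) g h _ (lexx _).
have := CS (Psi (x n)) g h _ (Psiq _); rewrite 2!(innerC (Psi _)).
have := M_le g h; have := M_le h g; have := W_le g h; have := cc_le g h.
set w' := \sum_(_ <= _ < _) _.
rewrite !ler_norml /r => /andP[? ?] /andP[? ?] /andP[? ?] /andP[? ?] /andP[? ?] /andP[? ?].
by apply/andP; split; lra.
Qed.

Lemma cov_deviation_le g h :
  `|\sum_(1 <= t < n.+1) inner (x t) g * inner (x t) h - n%:R * inner (C0 g) h| <=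
  (w + gam * q *+ 2 + `|x 1%N| ^+ 2 + (q * `|x n|) ^+ 2 + tau) / (1 - q ^+ 2) *
  (`|g| * `|h|).
Proof.
rewrite -/(D g h) -/r.
have [q0 q1] := andP q01.
have Q01 : 0 <= q ^+ 2 < 1 by rewrite exprn_ge0// expr_lt1.
have r0 : 0 <= r by rewrite !addr_ge0 ?mulr_ge0 ?exprn_ge0 ?mulr_ge0.
(* A crude bound to start the iteration; only its finiteness matters. *)
pose Lbd := \sum_(1 <= t < n.+1) `|x t| ^+ 2 + n%:R * K.
have Lbd0 : 0 <= Lbd.
  by rewrite addr_ge0 ?mulr_ge0// sumr_ge0// => t _; rewrite exprn_ge0.
have r10 : 0 <= r / (1 - q ^+ 2).
  by rewrite divr_ge0// subr_ge0 ltW//; case/andP: Q01.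
apply: (@contraction_bound _ _ Lbd) => // k; elim: k g h => [|k IH] g h.
  rewrite expr0 mul1r mulrDl; apply: ler_wpDr.
    by apply: mulr_ge0 => //; exact: mulr_ge0.
  rewrite mulrDl.
  rewrite (le_trans (ler_normB _ _))// lerD//.
    rewrite mulr_suml (le_trans (ler_norm_sum _ _ _))// ler_sum// => t _.
    rewrite normrM expr2 mulrACA ler_pM// cauchy_schwarz//.
  rewrite normrM normr_nat -mulrA ler_wpM2l//.
  by rewrite (le_trans (cauchy_schwarz _ _))// mulrA ler_wpM2r.
rewrite (le_trans (D_step _ IH _ _))//.
  by apply: addr_ge0 => //; apply: mulr_ge0 => //; do 2 apply: exprn_ge0.
(* r / (1 - q^2) is the fixed point of the map sending s to q^2 s + r. *)
suff <- : q ^+ 2 * (q ^+ 2 ^+ k * Lbd + r / (1 - q ^+ 2)) + r =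
    q ^+ 2 ^+ k.+1 * Lbd + r / (1 - q ^+ 2) by [].
rewrite [_ ^+ k.+1]exprS; field.
by rewrite subr_eq0 eq_sym lt_eqF//; case/andP: Q01.
Qed.

End covariance_recursion.

(** * Decomposition of the estimation error *)

Section estimator_error.
Context {R : realType} {V : preHilbertType R}.
Implicit Types (x : int -> V) (y z : V).

Definition centered x n := [seq x t%:Z - sample_mean x n | t <- index_iota 1 n.+1].

Lemma sample_cov0E x n z :
  sample_cov0 x n z = n%:R^-1 *: \sum_(u <- centered x n) inner u z *: u.
Proof. by rewrite /sample_cov0 /centered big_map /= fctE/= fct_sumE. Qed.

Lemma sample_cov0_ridge x n alpha :
  sample_cov0 x n + alpha *: (@idfun V) = ridge (centered x n) n%:R^-1 alpha.
Proof. by apply/funext => z; rewrite /ridge -sample_cov0E. Qed.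

Lemma sum_centered x n : (0 < n)%N -> \sum_(u <- centered x n) u = 0.
Proof.
move=> n0; rewrite big_map sumrB sumr_const_nat subn1/= -scaler_nat /sample_mean.
by rewrite scalerA divff ?scale1r ?subrr// pnatr_eq0 -lt0n.
Qed.

Context (Psi : {linear V -> V}) (x eps : int -> V) (n : nat).
Hypothesis n1 : (1 < n)%N.
Hypothesis x_rec : forall t, (0 < t < n)%N -> x t.+1%:Z = Psi (x t%:Z) + eps t.+1%:Z.

Let m := sample_mean x n.
Let Y t := x t%:Z - m.
Let c := m - Psi m.

(** What (n - 1) [sample_cov1] contains beside n Psi [sample_cov0]. With c = m - Psi m one has
    x_(t+1) - m = Psi Y_t + eps_(t+1) - c. The last tensor is a boundary effect: the lag-one sum
    stops at n - 1, and the Y_t with t < n add up to - Y_n. *)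
Definition noise_part z := \sum_(1 <= t < n) tensor (eps t.+1%:Z) (x t%:Z) z -
   tensor (\sum_(1 <= t < n) eps t.+1%:Z) m z + tensor (c - Psi (Y n)) (Y n) z.

Lemma sample_cov1E z : sample_cov1 x n z =
  (n.-1)%:R^-1 *: (n%:R *: Psi (sample_cov0 x n z) + noise_part z).
Proof.
have n0 : (0 < n)%N by exact: ltnW.
rewrite /sample_cov1 fctE/= fct_sumE; congr (_ *: _).
have -> : n%:R *: Psi (sample_cov0 x n z) = Psi (\sum_(u <- centered x n) inner u z *: u).
  by rewrite -(linearZZ Psi) sample_cov0E scalerA divff ?pnatr_eq0 -?lt0n// scale1r.
rewrite (linear_sum Psi) big_map.
rewrite big_nat_recr//= -/m -/(Y n) (linearZZ Psi).
under [in RHS]eq_bigr => t _ do rewrite (linearZZ Psi) -/m -/(Y t).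
transitivity (\sum_(1 <= t < n) (inner (Y t) z *: Psi (Y t) +
    (tensor (eps t.+1%:Z) (x t%:Z) z - inner m z *: eps t.+1%:Z - inner (Y t) z *: c))).
  apply: eq_big_nat => t tn; rewrite /tensor x_rec// -/m -/(Y t).
  have -> : Psi (x t%:Z) + eps t.+1%:Z - m = Psi (Y t) + (eps t.+1%:Z - c).
    rewrite /Y linearB /c opprB -!addrA; congr (_ + _).
    by rewrite [RHS]addrCA addKr.
  by rewrite scalerDr scalerBr -[in RHS]scalerBl -innerBl.
rewrite big_split/= -!addrA; congr (_ + _); rewrite /noise_part !sumrB -!scaler_sumr.
rewrite -scaler_suml.
have -> : \sum_(1 <= t < n) inner (Y t) z = - inner (Y n) z.
  apply/eqP; rewrite -addr_eq0 -(big_nat_recr _ 1 (fun t => inner (Y t) z))//=.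
  under eq_bigr do rewrite innerC.
  have /(congr1 (inner z)) := sum_centered x n0.
  by rewrite big_map raddf0 raddf_sum => ->.
rewrite /tensor scaleNr opprK [inner (Y n) z *: (c - _)]scalerBr.
by rewrite [RHS]addrCA; congr (_ + _); rewrite [RHS]addrC subrK.
Qed.

End estimator_error.

Section hs2_theory.
Context {R : realType} {V : preHilbertType R}.
Implicit Types (b : nat -> V) (A B : V -> V).

Lemma hs2_ge0 b A : (0 <= hs2 b A)%E.
Proof. by apply: nneseries_ge0 => k _ _; rewrite lee_fin exprn_ge0. Qed.

Lemma hs2_le_fun b A B (c : R) : 0 <= c -> (forall z, `|A z| ^+ 2 <= c * `|B z| ^+ 2) ->
  (hs2 b A <= c%:E * hs2 b B)%E.
Proof.
move=> c0 AB; rewrite -nneseriesZl; last by move=> k _; rewrite lee_fin exprn_ge0.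
apply: lee_nneseries => [k _ _|k _]; first by rewrite lee_fin exprn_ge0.
by rewrite -EFinM lee_fin.
Qed.

Lemma sqr_norm_add3 (u v w : V) :
  `|u + v + w| ^+ 2 <= 3 * (`|u| ^+ 2 + `|v| ^+ 2 + `|w| ^+ 2).
Proof.
have uvw : `|u + v + w| <= `|u| + `|v| + `|w|.
  by rewrite (le_trans (ler_normD _ _))// lerD2r ler_normD.
have : `|u + v + w| ^+ 2 <= (`|u| + `|v| + `|w|) ^+ 2.
  by rewrite lerXn2r// nnegrE// !addr_ge0.
move/le_trans; apply.
have := sqr_ge0 (`|u| - `|v|); have := sqr_ge0 (`|u| - `|w|).
have := sqr_ge0 (`|v| - `|w|).
nra.
Qed.

Lemma hs2_add3 b A1 A2 A3 :
  (hs2 b (fun z => A1 z + A2 z + A3 z)%R <=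
   3%:E * (hs2 b A1 + hs2 b A2 + hs2 b A3))%E.
Proof.
have h0 A : forall k, (0 <= (`|A (b k)| ^+ 2)%:E)%E.
  by move=> k; rewrite lee_fin exprn_ge0.
rewrite /hs2 -!nneseriesD//; last by move=> k _ _; rewrite adde_ge0.
rewrite -nneseriesZl; last by move=> k _; rewrite !adde_ge0.
apply: lee_nneseries => [k _ _|k _]; first exact: (h0 (fun z => A1 z + A2 z + A3 z)).
by rewrite -!EFinD -EFinM lee_fin sqr_norm_add3.
Qed.

Lemma hs2_tensor b (f g : V) : orthonormal_basis b ->
  hs2 b (tensor f g) = ((`|f| * `|g|) ^+ 2)%:E.
Proof.
move=> bb; rewrite /hs2 /tensor.
under eq_eseriesr => k _ do rewrite normrZ exprMn mulrC real_normK ?num_real// EFinM (innerC g).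
rewrite nneseriesZl; last by move=> k _; rewrite lee_fin sqr_ge0.
by rewrite parseval// -EFinM -exprMn.
Qed.

Lemma norm_tensor (f g z : V) : `|tensor f g z| <= `|f| * `|g| * `|z|.
Proof. by rewrite normrZ mulrC -mulrA ler_wpM2l// cauchy_schwarz. Qed.

End hs2_theory.

Section operator_power_linear.
Context {R : realType} {V : preHilbertType R}.

(** [is_operator_power] prescribes values only; linearity passes from the partial sums to their
    pointwise limit. *)
Lemma operator_power_linear (C B : V -> V) beta : is_operator_power C beta B -> linear B.
Proof.
move=> [lam [e [_ Bx]]] a x y.
have lim : a *: series (fun k => lam k `^ beta *: tensor (e k) (e k) x) n +
   series (fun k => lam k `^ beta *: tensor (e k) (e k) y) n @[n --> \oo] -->
   a *: B x + B y.
  apply: cvgD; last exact: Bx.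
  by apply: cvgZ; [exact: cvg_cst|exact: Bx].
apply: cvg_unique (Bx (a *: x + y)) _; first exact: norm_hausdorff.
apply: cvg_trans lim; apply: near_eq_cvg; near=> n.
rewrite /series/= scaler_sumr -big_split/=; apply: eq_bigr => k _.
by rewrite (linearP (tensor (e k) (e k))) scalerDr !scalerA [a * _]mulrC.
Unshelve. all: by end_near. Qed.

End operator_power_linear.

Section estimator_error_bound.
Context {R : realType} {V : preHilbertType R}.
Context (Psi : {linear V -> V}) (x eps : int -> V) (n : nat).

Let m := sample_mean x n.
Let Y t := x t%:Z - m.
Let c := m - Psi m.
Let N := noise_part Psi x eps n.

Lemma noise_part_linear : linear N.
Proof.
move=> a y z; rewrite /N /noise_part !linearP/=.
under eq_bigr do rewrite linearP.
rewrite big_split/= -scaler_sumr [X in X + _ = _]addrACA [LHS]addrACA; congr (_ + _).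
by rewrite !scalerDr.
Qed.

HB.instance Definition _ := GRing.isLinear.Build R V V *:%R N noise_part_linear.

(** A path-dependent bound whose purpose is the continuity required by [hs2_comp]; its size never
    enters the rate. *)
Lemma noise_part_bounded : exists K, forall z, `|N z| <= K * `|z|.
Proof.
exists (\sum_(1 <= t < n) `|eps t.+1%:Z| * `|x t%:Z| +
  `|\sum_(1 <= t < n) eps t.+1%:Z| * `|m| + `|c - Psi (Y n)| * `|Y n|) => z.
rewrite /N /noise_part !mulrDl (le_trans (ler_normD _ _))// lerD ?norm_tensor//.
rewrite (le_trans (ler_normB _ _))// lerD ?norm_tensor//.
rewrite mulr_suml (le_trans (ler_norm_sum _ _ _))// ler_sum// => t _.
exact: norm_tensor.
Qed.

Hypothesis n1 : (1 < n)%N.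
Hypothesis x_rec : forall t, (0 < t < n)%N -> x t.+1%:Z = Psi (x t%:Z) + eps t.+1%:Z.
Context (b : nat -> V) (F C0 Cb : {linear V -> V}) (alpha L del : R).
Hypothesis bb : orthonormal_basis b.
Hypotheses (cPsi : continuous Psi) (cF : continuous F).
Hypothesis PsiF : Psi =1 F \o Cb.
Hypotheses (a0 : 0 < alpha) (L0 : 0 < L) (del0 : 0 <= del).
Hypothesis Cb_le : forall y z, C0 y + alpha *: y = z -> alpha * `|Cb y| <= L * `|z|.
Hypothesis C0_del : forall y, `|C0 y - sample_cov0 x n y| <= del * `|y|.

Lemma far1_error_hs2 : (hs2 b (fun y => far1_estimator x n alpha y - Psi y)%R <= 3%:E *
  (((n.-1)%:R^-1 ^+ 2 * 4)%:E * hs2 b Psi +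
   ((n.-1)%:R^-1 ^+ 2 * alpha^-1 ^+ 2)%:E * hs2 b N +
   ((L * (1 + del / alpha)) ^+ 2)%:E * hs2 b F))%E.
Proof.
have n_ge0 : 0 <= n%:R^-1 :> R by rewrite invr_ge0.
have [B [pinvE SB B_le]] := ridge_pinv (centered x n) n_ge0 a0.
set k := (n.-1)%:R^-1.
(* The sample operators are normalised by n - 1 and by n; the ratio n k = 1 + k produces the extra
   term k Psi S. *)
have kn : k * n%:R = 1 + k.
  rewrite -[in n%:R](ltn_predK n1) -natr1 mulrDr mulr1 mulVf//.
  by rewrite pnatr_eq0 -lt0n -subn1 subn_gt0.
have SE y : sample_cov0 x n (B y) = y - alpha *: B y.
  by apply/eqP; rewrite eq_sym subr_eq -[X in X == _]SB /ridge -sample_cov0E.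
have linS : linear (fun y => sample_cov0 x n (B y)).
  move=> r y z; rewrite !SE !(linearP B) scalerDr scalerBr opprD addrACA.
  by rewrite !scalerA [r * _]mulrC.
pose S : {linear V -> V} := HB.pack (fun y => sample_cov0 x n (B y))
  (GRing.isLinear.Build R V V *:%R (fun y => sample_cov0 x n (B y)) linS).
(* The sample covariance after the ridge inverse is I - alpha B, of norm at most 2; its square is
   the 4 in the statement. *)
have S_le y : `|S y| <= 2 * `|y|.
  rewrite /= SE (le_trans (ler_normB _ _))// mulrDl mul1r lerD2l.
  by rewrite normrZ gtr0_norm// -ler_pdivlMl.
have linT : linear (fun y => alpha *: Cb (B y)).
  by move=> r y z; rewrite (linearP B) (linearP Cb) scalerDr !scalerA [r * _]mulrC.
pose T : {linear V -> V} := HB.pack (fun y => alpha *: Cb (B y))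
  (GRing.isLinear.Build R V V *:%R (fun y => alpha *: Cb (B y)) linT).
(* [C0 + alpha] after [B] differs from the identity by [C0 - sample_cov0] after [B], of norm at most
   del / alpha. *)
have T_le y : `|T y| <= L * (1 + del / alpha) * `|y|.
  rewrite /= normrZ gtr0_norm//.
  rewrite (le_trans (Cb_le (erefl (C0 (B y) + alpha *: B y))))// -mulrA ler_pM2l//.
  have -> : C0 (B y) + alpha *: B y = y + (C0 (B y) - sample_cov0 x n (B y)).
    by rewrite SE opprB [RHS]addrCA; congr (_ + _); rewrite [RHS]addrC subrK.
  rewrite (le_trans (ler_normD _ _))// mulrDl mul1r lerD2l.
  by rewrite (le_trans (C0_del _))// -mulrA ler_wpM2l.
have errE y : far1_estimator x n alpha y - Psi y =
    k *: Psi (S y) + k *: N (B y) + (- F (T y)).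
  rewrite -[LHS]/(sample_cov1 x n ('pinv_(fun=> 0) setT
      (sample_cov0 x n + alpha *: (@idfun V)) y) - Psi y).
  rewrite sample_cov0_ridge pinvE (sample_cov1E n1 x_rec).
  rewrite scalerDr scalerA kn scalerDl scale1r.
  have -> : F (T y) = alpha *: Psi (B y) by rewrite /= linearZZ PsiF.
  have -> : alpha *: Psi (B y) = Psi y - Psi (S y).
    by rewrite -linearB/= SE opprB addrC subrK linearZZ.
  by rewrite opprB -!addrA [LHS]addrCA; congr (_ + _); rewrite [LHS]addrCA.
have -> : hs2 b (fun y => far1_estimator x n alpha y - Psi y)%R =
    hs2 b (fun y => (k *: Psi (S y) + k *: N (B y) + (- F (T y)))%R).
  by apply: eq_eseriesr => j _; rewrite errE.
apply: (le_trans (hs2_add3 _ _ _ _)).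
apply: lee_wpmul2l; first by rewrite lee_fin.
have a1 : 0 < alpha^-1 by rewrite invr_gt0.
have La : 0 < L * (1 + del / alpha).
  by rewrite mulr_gt0// ltr_pwDl// divr_ge0// ltW.
have [KN N_le] := noise_part_bounded.
apply: leeD; [apply: leeD|].
- rewrite EFinM -muleA; apply: (@le_trans _ _ ((k ^+ 2)%:E * hs2 b (Psi \o S)))%E.
    by apply: hs2_le_fun => [|z]; rewrite ?sqr_ge0// normrZ exprMn real_normK ?num_real.
  apply: lee_wpmul2l; first by rewrite lee_fin sqr_ge0.
  have -> : 4%R = 2 ^+ 2 :> R by rewrite expr2; ring.
  exact: hs2_comp.
- rewrite EFinM -muleA; apply: (@le_trans _ _ ((k ^+ 2)%:E * hs2 b (N \o B)))%E.
    by apply: hs2_le_fun => [|z]; rewrite ?sqr_ge0// normrZ exprMn real_normK ?num_real.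
  apply: lee_wpmul2l; first by rewrite lee_fin sqr_ge0.
  apply: hs2_comp => //; exact: (bounded_additive_continuous N_le).
apply: (@le_trans _ _ (hs2 b (F \o T))).
  rewrite -[leRHS]mul1e; apply: hs2_le_fun => // z.
  by rewrite mul1r normrN.
exact: hs2_comp.
Qed.

End estimator_error_bound.

(** * Deterministic bounds along one path *)

Section bilinear_bound.
Context {R : realType} {V : preHilbertType R}.

(** The functional bound is applied one variable at a time, first in g with h fixed, then in h at
    each basis vector. The constant K provides continuity and does not survive in the conclusion. *)
Lemma bilinear_le_hs (b : nat -> V) (B : V -> V -> R) (K w : R) :
  orthonormal_basis b -> (forall g, scalar (B g)) -> (forall h, scalar (B^~ h)) ->
  (forall g h, `|B g h| <= K * `|g| * `|h|) -> 0 <= w ->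
  (\sum_(k <oo) \sum_(l <oo) (B (b k) (b l) ^+ 2)%:E <= (w ^+ 2)%:E)%E ->
  forall g h, `|B g h| <= w * `|g| * `|h|.
Proof.
move=> bb Br Bl BK w0 Bw g h.
pose Bg g' : {scalar V} := HB.pack (B g') (GRing.isLinear.Build R V R *%R (B g') (Br g')).
pose Bh h' : {scalar V} := HB.pack (B^~ h') (GRing.isLinear.Build R V R *%R (B^~ h') (Bl h')).
have cBg g' : continuous (Bg g') by exact: (bounded_additive_continuous (f := Bg g') (BK g')).
have cBh h' : continuous (Bh h').
  apply: (bounded_additive_continuous (f := Bh h') (K := K * `|h'|)) => y.
  by rewrite (le_trans (BK _ _))// mulrAC.
apply: le_of_sqr; first by rewrite !mulr_ge0.
rewrite real_normK ?num_real// -lee_fin.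
apply: (le_trans (scalar_le_nneseries (phi := Bh h) g bb (cBh h))).
apply: (@le_trans _ _ ((\sum_(k <oo) (\sum_(l <oo) (B (b k) (b l) ^+ 2)%:E) *
    (`|h| ^+ 2)%:E) * (`|g| ^+ 2)%:E)%E).
  apply: lee_wpmul2r; first by rewrite lee_fin exprn_ge0.
  apply: lee_nneseries => [k _ _|k _]; first by rewrite lee_fin sqr_ge0.
  exact: (scalar_le_nneseries (phi := Bg (b k)) h bb (cBg _)).
rewrite (mulrAC w) !exprMn [leRHS]EFinM; apply: lee_wpmul2r; first by rewrite lee_fin exprn_ge0.
under eq_eseriesr do rewrite muleC.
rewrite nneseriesZl; last by move=> k _; apply: nneseries_ge0 => l _ _; rewrite lee_fin sqr_ge0.
by rewrite muleC [leRHS]EFinM; apply: lee_wpmul2r => //; rewrite lee_fin exprn_ge0.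
Qed.

End bilinear_bound.

Section path_bound.
Context {R : realType} {V : preHilbertType R}.
Context (b : nat -> V) (Psi C0 : {linear V -> V}) (q : R) (cc : V -> V -> R).
Hypothesis bb : orthonormal_basis b.
Hypothesis q01 : 0 <= q < 1.
Hypothesis Psiq : forall x, `|Psi x| <= q * `|x|.
Hypothesis C0_lim : forall g h,
  inner (C0 (riesz_sum b (inner g \o Psi) J)) (riesz_sum b (inner h \o Psi) J)
    @[J --> \oo] --> inner (C0 g) h - cc g h.
Context (KC tau K : R).
Hypotheses (KC0 : 0 <= KC) (tau0 : 0 <= tau) (K0 : 0 <= K).
Hypothesis C0K : forall g, `|C0 g| <= KC * `|g|.
Hypothesis cc_le : forall g h, `|cc g h| <= tau * `|g| * `|h|.
Hypothesis cc_lin : forall h, scalar (cc^~ h).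
Hypothesis cc_sym : forall g h, cc g h = cc h g.

Context (n : nat) (x eps : int -> V).
Hypothesis n1 : (1 < n)%N.
Hypothesis x_rec : forall t, (0 < t < n)%N -> x t.+1%:Z = Psi (x t%:Z) + eps t.+1%:Z.
Hypotheses (x1_le : `|x 1%N| ^+ 2 <= K) (xn_le : `|x n| ^+ 2 <= K).
Hypothesis U_le : `|\sum_(1 <= t < n) eps t.+1%:Z| ^+ 2 <= K * n%:R.
Hypothesis G_le :
  (hs2 b (fun z => \sum_(1 <= t < n) tensor (eps t.+1%:Z) (x t%:Z) z)%R <= (K * n%:R)%:E)%E.
Let W g h := \sum_(1 <= t < n) (inner (eps t.+1%:Z) g * inner (eps t.+1%:Z) h - cc g h).
Hypothesis W_le : (\sum_(k <oo) \sum_(l <oo) (W (b k) (b l) ^+ 2)%:E <= (K * n%:R)%:E)%E.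

Let s := Num.sqrt n%:R : R.
Let kap := Num.sqrt K : R.
Let r := kap * s.
Let A := 3 / (1 - q).
Let m := sample_mean x n.

Let n0 : (0 < n)%N. Proof. exact: ltnW. Qed.
Let s1 : 1 <= s. Proof. by rewrite -sqrtr1 ler_sqrt ?ler1n. Qed.
Let ss : s ^+ 2 = n%:R. Proof. by rewrite sqr_sqrtr. Qed.
Let kap0 : 0 <= kap. Proof. exact: sqrtr_ge0. Qed.
Let kk : kap ^+ 2 = K. Proof. by rewrite sqr_sqrtr. Qed.
Let q0 : 0 <= q. Proof. by case/andP: q01. Qed.
Let q1 : 0 < 1 - q. Proof. by rewrite subr_gt0; case/andP: q01. Qed.
Let A0 : 0 <= A. Proof. by rewrite divr_ge0// ltW. Qed.
Let rr : r ^+ 2 = K * n%:R. Proof. by rewrite exprMn kk ss. Qed.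
Let r0 : 0 <= r. Proof. by rewrite mulr_ge0// (le_trans ler01). Qed.

Let le_r (v : V) : `|v| ^+ 2 <= K * n%:R -> `|v| <= r.
Proof. by move=> vK; apply: le_of_sqr => //; rewrite rr. Qed.

Let le_kap (v : V) : `|v| ^+ 2 <= K -> `|v| <= kap.
Proof. by move=> vK; apply: le_of_sqr => //; rewrite kk. Qed.

Let sqr_mul_le (a1 a2 b1 b2 : R) : 0 <= a1 -> 0 <= b1 -> a1 <= a2 -> b1 <= b2 ->
  (a1 * b1) ^+ 2 <= (a2 * b2) ^+ 2.
Proof.
move=> a10 b10 a12 b12; have le := ler_pM a10 b10 a12 b12.
rewrite lerXn2r ?nnegrE//; first exact: mulr_ge0.
by rewrite (le_trans _ le)// mulr_ge0.
Qed.

Let kap_r : kap <= r. Proof. by rewrite ler_peMr. Qed.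

(** Summing the recursion gives S - x_1 = Psi (S - x_n) plus the innovation sum. Hence (1 - q) |S|
    is at most |x_1| + |x_n| plus the norm of that sum, three terms bounded by r, which is the 3 in
    [A]. *)
Lemma sample_mean_le : `|m| <= A * kap / s.
Proof.
pose S := \sum_(1 <= t < n.+1) x t%:Z.
have SE : S - x 1%N = Psi (S - x n) + \sum_(1 <= t < n) eps t.+1%:Z.
  rewrite /S {1}big_ltn// addrAC subrr add0r big_add1/= big_nat_recr//= addrK.
  by rewrite linear_sum -big_split/=; apply: eq_big_nat => t tn; rewrite x_rec.
have S_le : (1 - q) * `|S| <= 3 * r.
  have : `|S| <= `|x 1%N| + (q * (`|S| + `|x n|) + `|\sum_(1 <= t < n) eps t.+1%:Z|).
    rewrite -{1}[S](subrK (x 1%N)) SE [X in _ <= X]addrC.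
    rewrite (le_trans (ler_normD _ _))// lerD2r (le_trans (ler_normD _ _))// lerD2r.
    by rewrite (le_trans (Psiq _))// ler_wpM2l// ler_normB.
  have := le_r U_le; have := le_trans (le_kap x1_le) kap_r.
  have := le_trans (le_kap xn_le) kap_r; have := normr_ge0 (x n).
  have : q <= 1 by have := q1; lra.
  by move: q0; nra.
rewrite /m /sample_mean normrZ ger0_norm ?invr_ge0// -/S -ss.
have s0 : 0 < s by exact: lt_le_trans s1.
have -> : A * kap / s = s ^- 2 * (A * r) by rewrite /r; field; exact: lt0r_neq0.
rewrite ler_wpM2l ?invr_ge0 ?exprn_ge0 ?(ltW s0)//.
by rewrite /A mulrAC ler_pdivlMr// mulrC.
Qed.

Let Y := x n - m.
Let c := m - Psi m.

Let m_le : `|m| <= A * kap.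
Proof.
rewrite (le_trans sample_mean_le)// ler_pdivrMr ?(lt_le_trans _ s1)//.
by rewrite ler_peMr// mulr_ge0.
Qed.

Let Psi_le y : `|Psi y| <= `|y|.
Proof. by rewrite (le_trans (Psiq y))// ler_piMl// -subr_ge0 ltW. Qed.

Let Y_le : `|Y| <= (1 + A) * kap.
Proof. by rewrite (le_trans (ler_normB _ _))// mulrDl mul1r lerD// le_kap. Qed.

Let cY_le : `|c - Psi Y| <= (1 + 3 * A) * kap.
Proof.
rewrite (le_trans (ler_normB _ _))//.
have := le_trans (Psi_le Y) Y_le.
have : `|c| <= `|m| + `|Psi m| by exact: ler_normB.
by have := Psi_le m; have := m_le; lra.
Qed.

(** One summand for each tensor of [noise_part], with the factor 3 of [hs2_add3]: the cross sum, the
    innovation sum against the mean, and the boundary term, where |Y| <= (1 + A) kap and |c - Psi Y|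
    <= (1 + 3 A) kap with kap^2 = K. *)
Definition noise_const := 3 * (K + A ^+ 2 * K ^+ 2 + ((1 + 3 * A) * (1 + A)) ^+ 2 * K ^+ 2).

(** Only the squared norm of the cross sum is of order n. The innovation sum is of order n^(1/2) and
    the mean of order n^(-1/2), so their tensor stays bounded, like the boundary term. *)
Lemma noise_part_le : (hs2 b (noise_part Psi x eps n) <= (noise_const * n%:R)%:E)%E.
Proof.
apply: (le_trans (hs2_add3 _ _ (fun z => - tensor (\sum_(1 <= t < n) eps t.+1%:Z) m z) _)).
rewrite /noise_const -mulrA EFinM; apply: lee_wpmul2l; first by rewrite lee_fin.
have K1 : 0 <= K ^+ 2 by rewrite exprn_ge0.
have n1R : 1 <= n%:R :> R by rewrite ler1n.
rewrite 2!mulrDl !EFinD; apply: leeD; [apply: leeD => //|].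
  apply: (@le_trans _ _ (hs2 b (tensor (\sum_(1 <= t < n) eps t.+1%:Z) m))).
    by rewrite -[leRHS]mul1e; apply: hs2_le_fun => // z; rewrite mul1r normrN.
  rewrite hs2_tensor// lee_fin.
  apply: (@le_trans _ _ ((r * (A * kap / s)) ^+ 2)).
    by apply: sqr_mul_le => //; [exact: le_r|exact: sample_mean_le].
  have -> : r * (A * kap / s) = A * K.
    by rewrite -kk /r; field; rewrite lt0r_neq0// (lt_le_trans _ s1).
  by rewrite exprMn ler_peMr// mulr_ge0// exprn_ge0.
rewrite hs2_tensor// lee_fin.
apply: (@le_trans _ _ ((((1 + 3 * A) * kap) * ((1 + A) * kap)) ^+ 2)).
  exact: sqr_mul_le.
by rewrite mulrACA -expr2 kk exprMn ler_peMr// mulr_ge0// sqr_ge0.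
Qed.

(** The bound of [cov_deviation_le] with w = gam = kap s, where s = n^(1/2) >= 1: w + 2 gam q
    contributes 3 kap, the two end points contribute 2 K, all up to the factor s. The last summand
    comes from the squared mean. *)
Definition cov_const := (3 * kap + 2 * K + tau) / (1 - q ^+ 2) + A ^+ 2 * K.

Let W_bound g h : `|W g h| <= r * `|g| * `|h|.
Proof.
apply: (@bilinear_le_hs _ _ b W (\sum_(1 <= t < n) (`|eps t.+1%:Z| ^+ 2 + tau))) => //.
- move=> g' a y z; rewrite /W mulr_sumr -big_split/=; apply: eq_bigr => t _.
  by rewrite inner_is_scalar !(cc_sym g') cc_lin /=; ring.
- move=> h' a y z; rewrite /W mulr_sumr -big_split/=; apply: eq_bigr => t _.
  by rewrite inner_is_scalar cc_lin /=; ring.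
- move=> g' h'; rewrite -mulrA mulr_suml (le_trans (ler_norm_sum _ _ _))// ler_sum// => t _.
  rewrite mulrDl (le_trans (ler_normB _ _))// lerD//; last by rewrite mulrA.
  rewrite normrM expr2 mulrACA ler_pM// cauchy_schwarz//.
- by rewrite rr.
Qed.

Let G_bound g h :
  `|inner (\sum_(1 <= t < n) tensor (eps t.+1%:Z) (x t%:Z) g) h| <= r * `|g| * `|h|.
Proof.
apply: (@bilinear_le_hs _ _ b
  (fun g h => inner (\sum_(1 <= t < n) tensor (eps t.+1%:Z) (x t%:Z) g) h)
  (\sum_(1 <= t < n) `|eps t.+1%:Z| * `|x t%:Z|)) => //.
- by move=> g'; exact: inner_is_scalar.
- move=> h' a y z; rewrite !(innerC _ h') -(inner_is_scalar h'); congr inner.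
  by rewrite scaler_sumr -big_split/=; apply: eq_bigr => t _; rewrite linearP.
- move=> g' h'; rewrite (le_trans (cauchy_schwarz _ _))// ler_wpM2r//.
  rewrite mulr_suml (le_trans (ler_norm_sum _ _ _))// ler_sum// => t _.
  exact: norm_tensor.
- rewrite rr; apply: le_trans G_le; rewrite /hs2.
  apply: lee_nneseries => [k _ _|k _].
    by apply: nneseries_ge0 => l _ _; rewrite lee_fin sqr_ge0.
  by under eq_eseriesr do rewrite innerC; rewrite parseval.
Qed.

(** Centering subtracts the tensor square of the mean, of order 1 / n only; the uncentred sum
    deviates from n C0 by order n^(1/2). *)
Lemma sample_cov0_deviation y :
  `|C0 y - sample_cov0 x n y| <= cov_const / s * `|y|.
Proof.
have s0 : 0 < s by exact: lt_le_trans s1.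
have Q1 : 0 < 1 - q ^+ 2 by rewrite subr_gt0 expr_lt1//; case/andP: q01.
have cc0 : 0 <= cov_const.
  apply: addr_ge0; last by rewrite mulr_ge0// sqr_ge0.
  by apply: divr_ge0; [rewrite !addr_ge0 ?mulr_ge0|exact: ltW].
apply: norm_le_inner; first by rewrite mulr_ge0// divr_ge0// ltW.
move=> h.
pose D := \sum_(1 <= t < n.+1) inner (x t%:Z) y * inner (x t%:Z) h - n%:R * inner (C0 y) h.
have D_le : `|D| <= (3 * kap + 2 * K + tau) / (1 - q ^+ 2) * s * (`|y| * `|h|).
  apply: (le_trans (@cov_deviation_le _ _ b Psi C0 q cc bb q01 Psiq C0_lim n
    (fun t => x t%:Z) (fun t => eps t%:Z) KC r r tau n0 KC0 r0 r0 tau0 x_rec C0K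
    cc_le W_bound G_bound y h)).
  apply: ler_wpM2r; first exact: mulr_ge0.
  rewrite [leRHS]mulrAC ler_pM2r ?invr_gt0//.
  have qx : (q * `|x n|) ^+ 2 <= K.
    apply: le_trans xn_le; rewrite lerXn2r ?nnegrE ?mulr_ge0// ler_piMl//.
    by rewrite -subr_ge0 ltW.
  have : r * q <= r by rewrite ler_piMr// -subr_ge0 ltW.
  have : 2 * K <= 2 * K * s by rewrite ler_peMr// mulr_ge0.
  have : tau <= tau * s by rewrite ler_peMr.
  by move: x1_le qx; rewrite /r; nra.
have -> : inner (C0 y - sample_cov0 x n y) h = - (n%:R^-1 * D) + inner m y * inner m h.
  rewrite innerBl sample_cov0E innerZl big_map.
  have -> : inner (\sum_(1 <= t < n.+1) inner (x t%:Z - m) y *: (x t%:Z - m)) h =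
      \sum_(1 <= t < n.+1) inner (x t%:Z) y * inner (x t%:Z) h - n%:R * (inner m y * inner m h).
    rewrite innerC linear_sum/=.
    have S u : \sum_(1 <= t < n.+1) inner (x t%:Z) u = n%:R * inner m u.
      rewrite /m /sample_mean innerZl mulrA divff ?pnatr_eq0 -?lt0n// mul1r.
      by rewrite innerC linear_sum; apply: eq_bigr => t _; rewrite innerC.
    transitivity (\sum_(1 <= t < n.+1) (inner (x t%:Z) y * inner (x t%:Z) h -
       (inner (x t%:Z) y * inner m h + inner m y * inner (x t%:Z) h - inner m y * inner m h))).
      by apply: eq_bigr => t _; rewrite innerZr innerBl innerBr !(innerC h); ring.
    rewrite sumrB; congr (_ - _); rewrite sumrB big_split/= -mulr_suml -mulr_sumr !S.
    by rewrite sumr_const_nat subn1 -mulr_natl/=; ring.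
  rewrite /D; field; by rewrite pnatr_eq0 -lt0n.
rewrite -!mulrA /cov_const mulrDl (le_trans (ler_normD _ _))// lerD//.
  rewrite normrN normrM ger0_norm ?invr_ge0// ler_pdivrMl ?ltr0n// (le_trans D_le)//.
  rewrite -ss le_eqVlt; apply/orP; left; apply/eqP; field.
  by rewrite !lt0r_neq0.
apply: (@le_trans _ _ ((A * kap / s * `|y|) * (A * kap / s * `|h|))).
  rewrite normrM ler_pM// (le_trans (cauchy_schwarz _ _))// ler_wpM2r//; exact: sample_mean_le.
have -> : A * kap / s * `|y| * (A * kap / s * `|h|) =
    A ^+ 2 * K * (s^-1 * (`|y| * `|h|)) / s.
  by rewrite -kk; field; exact: lt0r_neq0.
rewrite ler_pdivrMr// ler_peMr//.
apply: mulr_ge0; first by rewrite mulr_ge0// sqr_ge0.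
by rewrite !mulr_ge0// invr_ge0 ltW.
Qed.

End path_bound.

(** * Independence and martingale differences *)

Section independent_product.
Context d (Omega : measurableType d) (R : realType) (P : probability Omega R).
Implicit Types Y Z : Omega -> R.

Definition indep2 Y Z := forall A B : set R, measurable A -> measurable B ->
  P (Y @^-1` A `&` Z @^-1` B) = (P (Y @^-1` A) * P (Z @^-1` B))%E.

Let measurable_mulpair : measurable_fun setT (fun z : R * R => z.1 * z.2).
Proof. by apply: measurable_funM; [exact: measurable_fst|exact: measurable_snd]. Qed.

(** The joint law and the product of the marginals agree on rectangles, hence everywhere, and
    Tonelli applies. The second point w' plays the part of an independent copy, so no second
    probability space is needed. *)
Lemma indep2_pushforward Y Z (mY : measurable_fun setT Y) (mZ : measurable_fun setT Z) :
  indep2 Y Z -> forall f : R * R -> \bar R, measurable_fun setT f ->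
  (forall z, (0 <= f z)%E) ->
  (\int[P]_w f (Y w, Z w) = \int[P]_w \int[P]_w' f (Y w, Z w'))%E.
Proof.
move=> YZ f mf f0.
pose Y' : {RV P >-> R} := mfun_Sub (mem_set mY).
pose Z' : {RV P >-> R} := mfun_Sub (mem_set mZ).
have mYZ : measurable_fun setT (fun w => (Y w, Z w)) by exact: measurable_fun_pair.
pose YZ' : {RV P >-> (R * R)%type} := mfun_Sub (mem_set mYZ).
pose PY := distribution P Y'. pose PZ := distribution P Z'.
pose J := distribution P YZ'.
have JE : forall A, measurable A -> (PY \x PZ)%E A = J A.
  by apply: product_measure_unique => A B mA mB; rewrite -YZ.
rewrite -[LHS]/(\int[P]_w (f \o YZ') w)%E -ge0_integral_distribution//.
rewrite (eq_measure_integral (PY \x PZ)%E); last by move=> A mA _; exact/esym/JE.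
rewrite fubini_tonelli1//.
rewrite ge0_integral_distribution//=; last first.
- by move=> x; apply: integral_ge0 => y _.
- exact: measurable_fun_fubini_tonelli_F.
apply: eq_integral => w _ /=; rewrite /fubini_F ge0_integral_distribution//.
by apply: measurableT_comp => //; exact: pair1_measurable.
Qed.

Lemma indep2_expectation_abs Y Z (mY : measurable_fun setT Y) (mZ : measurable_fun setT Z) :
  indep2 Y Z ->
  (\int[P]_w (`|Y w * Z w|)%:E =
   (\int[P]_w (`|Y w|)%:E) * \int[P]_w (`|Z w|)%:E)%E.
Proof.
move=> YZ.
rewrite (indep2_pushforward mY mZ YZ (f := fun z => (`|z.1 * z.2|)%:E))//; last first.
  by apply/measurable_EFinP; apply: measurableT_comp => //; exact: measurable_mulpair.
have mnZ : measurable_fun setT (fun w => (`|Z w|)%:E).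
  by apply/measurable_EFinP; exact: measurableT_comp.
have mnY : measurable_fun setT (fun w => (`|Y w|)%:E).
  by apply/measurable_EFinP; exact: measurableT_comp.
under eq_integral => w _.
  under eq_integral => w' _ do rewrite /= normrM EFinM.
  rewrite ge0_integralZl//.
  over.
by rewrite ge0_integralZr// integral_ge0.
Qed.

Lemma indep2_integrable Y Z : indep2 Y Z ->
  P.-integrable setT (EFin \o Y) -> P.-integrable setT (EFin \o Z) ->
  P.-integrable setT (fun w => (Y w * Z w)%:E).
Proof.
move=> YZ /integrableP[/measurable_EFinP mY iY] /integrableP[/measurable_EFinP mZ iZ].
apply/integrableP; split.
  by apply/measurable_EFinP; exact: measurable_funM.
rewrite [ltLHS](_ : _ = \int[P]_w (`|Y w * Z w|)%:E)%E//.
by rewrite indep2_expectation_abs// lte_mul_pinfty// ?integral_ge0// ge0_fin_numE// integral_ge0.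
Qed.

(** [indep2_pushforward] concerns nonnegative functions, so the two parts of the product are treated
    separately: a mean is zero exactly when the integrals of the positive and negative parts agree,
    and this is checked for each fixed value of [Y]. *)
Lemma indep2_expectation0 Y Z : indep2 Y Z ->
  P.-integrable setT (EFin \o Y) -> P.-integrable setT (EFin \o Z) ->
  (\int[P]_w (Z w)%:E = 0)%E -> (\int[P]_w (Y w * Z w)%:E = 0)%E.
Proof.
move=> YZ iY iZ Z0; have iYZ := indep2_integrable YZ iY iZ.
have [/measurable_EFinP mY _] := integrableP _ _ _ iY.
have [/measurable_EFinP mZ _] := integrableP _ _ _ iZ.
have posneg (f : Omega -> \bar R) : P.-integrable setT f ->
    (\int[P]_w f w = 0)%E <-> (\int[P]_w f^\+ w = \int[P]_w f^\- w)%E.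
  move=> intf; rewrite integralE; have n := integrable_neg_fin_num measurableT intf.
  rewrite -(fineK n) -(fineK (integrable_pos_fin_num measurableT intf)) -EFinB.
  by split => [[/subr0_eq ->]|[->]]; rewrite ?subrr.
pose f := fun z : R * R => (z.1 * z.2)%:E.
have mf : measurable_fun setT f by exact/measurable_EFinP.
have Ep := indep2_pushforward mY mZ YZ (measurable_funepos mf) (funepos_ge0 f).
have En := indep2_pushforward mY mZ YZ (measurable_funeneg mf) (funeneg_ge0 f).
apply: (posneg _ iYZ).2.
rewrite (eq_integral (fun w => f^\+ (Y w, Z w))%E); last by move=> w _; rewrite !funeposE.
rewrite [RHS](eq_integral (fun w => f^\- (Y w, Z w))%E); last by move=> w _; rewrite !funenegE.
rewrite Ep En; apply: eq_integral => w _.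
rewrite (eq_integral (fun w' => (Y w * Z w')%:E)^\+%E); last by move=> w' _; rewrite !funeposE.
rewrite [RHS](eq_integral (fun w' => (Y w * Z w')%:E)^\-%E); last by move=> w' _; rewrite !funenegE.
apply: (posneg (fun w' => (Y w * Z w')%:E) _).1.
  by under eq_fun do rewrite EFinM; exact: integrableZl.
under eq_integral do rewrite EFinM.
by rewrite integralZl// Z0 mule0.
Qed.

End independent_product.

Section square_integrable.
Context d (Omega : measurableType d) (R : realType) (P : probability Omega R).
Implicit Types Y Z : Omega -> R.

Definition sq_integrable Y := measurable_fun setT Y /\
  (\int[P]_w (Y w ^+ 2)%:E < +oo)%E.

Let measurable_sqr Y : measurable_fun setT Y ->
  measurable_fun setT (fun w => (Y w ^+ 2)%:E).
Proof. by move=> mY; apply/measurable_EFinP; exact: measurable_funX. Qed.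

Lemma sq_integrable_mul Y Z : sq_integrable Y -> sq_integrable Z ->
  P.-integrable setT (fun w => (Y w * Z w)%:E).
Proof.
move=> [mY iY] [mZ iZ].
apply: (@le_integrable _ _ _ _ _ measurableT _ (fun w => (Y w ^+ 2 + Z w ^+ 2)%:E)).
- by apply/measurable_EFinP; exact: measurable_funM.
- move=> w _; rewrite lee_fin [leRHS]ger0_norm ?addr_ge0 ?sqr_ge0//.
  by rewrite ler_norml; apply/andP; split; nra.
apply: (integrableD measurableT (f := fun w => (Y w ^+ 2)%:E) (g := fun w => (Z w ^+ 2)%:E)).
- apply/integrableP; split; first exact: measurable_sqr.
  by under eq_integral do rewrite gee0_abs ?lee_fin ?sqr_ge0//.
- apply/integrableP; split; first exact: measurable_sqr.
  by under eq_integral do rewrite gee0_abs ?lee_fin ?sqr_ge0//.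
Qed.

Lemma sq_integrable_cst (c : R) : sq_integrable (fun=> c).
Proof.
split; first exact: measurable_cst.
by rewrite -[ltLHS]/(\int[P]_w (cst (c ^+ 2)%:E) w)%E integral_cst//= probability_setT mule1 ltry.
Qed.

Lemma sq_integrableD Y Z : sq_integrable Y -> sq_integrable Z ->
  sq_integrable (fun w => Y w + Z w).
Proof.
move=> [mY iY] [mZ iZ]; split; first exact: measurable_funD.
apply: (@le_lt_trans _ _ (\int[P]_w (2%:E * (Y w ^+ 2)%:E + 2%:E * (Z w ^+ 2)%:E))%E).
  apply: ge0_le_integral => //.
  - by move=> w _; rewrite lee_fin sqr_ge0.
  - by apply: measurable_sqr; exact: measurable_funD.
  - by apply: emeasurable_funD; apply: emeasurable_funM => //; exact: measurable_sqr.
  - by move=> w _; rewrite -!EFinM -EFinD lee_fin; have := sqr_ge0 (Y w - Z w); nra.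
have h (T : Omega -> R) w : (0 <= (T w ^+ 2)%:E)%E by rewrite lee_fin sqr_ge0.
have h2 (T : Omega -> R) w : (0 <= 2%:E * (T w ^+ 2)%:E)%E by rewrite mule_ge0.
rewrite ge0_integralD//; try (by apply: emeasurable_funM => //; exact: measurable_sqr).
rewrite !ge0_integralZl//; try exact: measurable_sqr.
by rewrite lte_add_pinfty// lte_mul_pinfty.
Qed.

Lemma sq_integrable_integrable Y : sq_integrable Y -> P.-integrable setT (EFin \o Y).
Proof.
move=> iY; have := sq_integrable_mul iY (sq_integrable_cst 1).
by under eq_fun do rewrite mulr1.
Qed.

End square_integrable.

(** * The sigma-algebra generated by past innovations *)

Section past.
Context d (Omega : measurableType d) (R : realType) (P : probability Omega R).
Context d' (S : measurableType d') (eps : int -> Omega -> S).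
Hypothesis meps : forall t, measurable_fun setT (eps t).
Hypothesis ieps : mutually_independent P eps.

(** One family indexed by all integers, trivial outside [s] and after [t], makes the intersection of
    two cylinders pointwise. *)
Definition past_cylinder (t : int) : set (set Omega) := [set A |
  exists (s : seq int) (B : int -> set S), [/\ uniq s, forall i, measurable (B i),
    forall i, i \notin s -> B i = setT, forall i : int, t < i -> B i = setT &
    A = [set w | forall i, B i (eps i w)]]].

(* The null sets are included so that [X t], an almost sure limit, is
   measurable with respect to its own past. *)
Definition past_gen t := past_cylinder t `|` [set A | measurable A /\ P A = 0%E].

Let cylinder_bigcap (s : seq int) B : (forall i, i \notin s -> B i = setT) ->
  [set w | forall i, B i (eps i w)] = \bigcap_(i in [set` s]) (eps i @^-1` B i).
Proof.
move=> sB; apply/seteqP; split => [w /= h i _|w /= h i]; first exact: h.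
by have [/h//|/sB ->] := boolP (i \in s).
Qed.

Lemma past_gen_measurable t : past_gen t `<=` measurable.
Proof.
move=> A [[s [B [_ mB sB _ ->]]]|[]//].
rewrite (cylinder_bigcap sB); apply: fin_bigcap_measurable; first exact: finite_seq.
by move=> i _; rewrite -[X in measurable X]setTI; exact: meps.
Qed.

(** The pi-system property behind the independence lemma below; an intersection with a null
    generator is null again. *)
Lemma past_gen_setI t : setI_closed (past_gen t).
Proof.
have null (A B : set Omega) : measurable A -> measurable B -> P A = 0%E -> P (A `&` B) = 0%E.
  move=> mA mB A0; apply/eqP; rewrite eq_le measure_ge0 andbT -A0.
  by apply: le_measure; rewrite ?inE//; exact: measurableI.
move=> A B HA HB.
have [mA mB] := (past_gen_measurable HA, past_gen_measurable HB).
case: HA => [[s [C [us mC sC tC AE]]]|[_ A0]]; last first.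
  by right; split; [exact: measurableI|exact: null].
case: HB => [[s' [C' [us' mC' sC' tC' BE]]]|[_ B0]]; last first.
  by right; split; [exact: measurableI|rewrite setIC; exact: null].
left; exists (undup (s ++ s')), (fun i => C i `&` C' i); split.
- exact: undup_uniq.
- by move=> i; exact: measurableI.
- move=> i; rewrite mem_undup mem_cat negb_or => /andP[/sC -> /sC' ->].
  by rewrite setTI.
- by move=> i ti; rewrite tC// tC'// setTI.
- rewrite AE BE; apply/seteqP; split => [w [/= h h'] i|w /= h]; first by split.
  by split => i; have [] := h i.
Qed.

Lemma past_sub t : <<s past_gen t >> `<=` measurable.
Proof.
apply: smallest_sub; last exact: past_gen_measurable.
split; first exact: measurable0.
- by move=> A mA; rewrite setTD; exact: measurableC.
- by move=> F mF; exact: bigcupT_measurable.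
Qed.

(** Dynkin's argument: the events independent of a given event of eps_(t+1) form a lambda-system. It
    contains the cylinders by mutual independence and the null sets trivially. *)
Lemma past_indep t A C : <<s past_gen t >> A -> measurable C ->
  P (A `&` eps (t + 1) @^-1` C) = (P A * P (eps (t + 1) @^-1` C))%E.
Proof.
move=> pA mC; set E := eps (t + 1) @^-1` C.
have mE : measurable E by rewrite -[E]setTI; exact: meps.
pose H := [set A | measurable A /\ P (A `&` E) = (P A * P E)%E].
suff: H A by case.
move: pA; apply: lambda_system_subset => //.
- exact: past_gen_setI.
- apply/dynkin_lambda_system; split.
  + by split; [exact: measurableT|rewrite setTI probability_setT mul1e].
  + move=> B [mB BE]; split; first exact: measurableC.
    rewrite setIC -setDE measureD// ?ltey_eq ?fin_num_measure//.
    rewrite probability_setC// muleBl ?fin_num_measure ?mul1e//.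
    by congr (_ - _)%E; rewrite setIC; exact: BE.
  + move=> F tF FH; have mF n : measurable (F n) by case: (FH n).
    have mU := bigcupT_measurable F mF.
    split => //; rewrite setI_bigcupl measure_bigcup//; last 2 first.
      by move=> n _; exact: measurableI.
      exact: trivIset_setIr.
    rewrite [P (\bigcup_k _)]measure_bigcup// -(fineK (fin_num_measure P _ mE)) muleC.
    rewrite -nneseriesZl; last by move=> n _; exact: measure_ge0.
    apply: eq_eseriesr => n _; rewrite fineK ?fin_num_measure// muleC.
    by have [_ ] := FH n.
- move=> B HB; have mB := past_gen_measurable HB; split => //.
  case: HB => [[s [D [us mD sD tD BE]]]|[_ B0]]; last first.
    rewrite B0 mul0e; apply/eqP; rewrite eq_le measure_ge0 andbT -B0.
    by apply: le_measure; rewrite ?inE//; exact: measurableI.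
  (* The list may mention t + 1, with a trivial constraint; it is removed there so that t + 1 can be
     added, constrained by [C], without duplicates. *)
  pose s0 := [seq i <- s | i != t + 1].
  have us0 : uniq s0 by exact: filter_uniq.
  have Dt : D (t + 1) = setT by apply: tD; rewrite ltrDl.
  have s0D i : i \notin s0 -> D i = setT.
    rewrite mem_filter negb_and negbK => /orP[/eqP ->//|/sD//].
  pose D' i := if i == t + 1 then C else D i.
  have mD' i : measurable (D' i) by rewrite /D'; case: ifP.
  have tD' i : i \notin t + 1 :: s0 -> D' i = setT.
    by rewrite in_cons negb_or /D' => /andP[/negbTE -> /s0D].
  have -> : B `&` E = [set w | forall i, D' i (eps i w)].
    rewrite BE; apply/seteqP; split => [w [/= h Ew] i|w /= h].
      by rewrite /D'; case: eqP => [->|_].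
    split => [i|]; last by have := h (t + 1); rewrite /D' eqxx.
    by have := h i; rewrite /D'; case: eqP => // -> _; rewrite Dt.
  rewrite BE (cylinder_bigcap tD') (cylinder_bigcap s0D) !ieps//; last first.
    by rewrite /= us0 andbT mem_filter eqxx.
  rewrite big_cons /D' eqxx -/E muleC; congr (_ * _)%E.
  by rewrite big_seq [RHS]big_seq; apply: eq_bigr => i; rewrite mem_filter => /andP[/negbTE ->].
Qed.

Notation past_type t := (g_sigma_algebraType (past_gen t)).

Lemma past_measurable t (Y : Omega -> R) :
  measurable_fun setT (Y : past_type t -> R) -> measurable_fun setT Y.
Proof.
by move=> mY _ B mB; rewrite setTI; apply: (@past_sub t); rewrite -[X in _ X]setTI; exact: mY.
Qed.

Lemma past_mono s t : s <= t -> past_gen s `<=` past_gen t.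
Proof.
move=> st A [[r [B [ur mB rB sB AE]]]|A0]; last by right.
left; exists r, B; split => // i ti; apply: sB; exact: le_lt_trans ti.
Qed.

Lemma past_type_mono s t (Y : Omega -> R) : s <= t ->
  measurable_fun setT (Y : past_type s -> R) ->
  measurable_fun setT (Y : past_type t -> R).
Proof.
move=> st mY _ B mB; have := mY measurableT B mB.
exact: (sub_sigma_algebra2 (past_mono st)).
Qed.

Lemma past_eps s t (g : S -> R) : s <= t -> measurable_fun setT g ->
  measurable_fun setT (g \o eps s : past_type t -> R).
Proof.
move=> st mg _ B mB; rewrite setTI; apply: sub_sigma_algebra; left.
exists [:: s], (fun i => if i == s then g @^-1` B else setT); split => //.
- by move=> i; case: ifP => // _; rewrite -[X in measurable X]setTI; exact: mg.
- by move=> i; rewrite inE => /negbTE ->.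
- by move=> i ti; case: eqP => // is_; move: ti; rewrite is_ ltNge st.
apply/seteqP; split => [w /= Bw i|w /= /(_ s)]; last by rewrite eqxx.
by case: eqP => [->|].
Qed.

(** Off the exceptional null set [N] the function is a pointwise limit; inside [N] every measurable
    piece is null, hence itself a generator of the past. *)
Lemma past_ae_limit t (Y : Omega -> R) (f : nat -> Omega -> R) :
  measurable_fun setT Y -> (forall n, measurable_fun setT (f n : past_type t -> R)) ->
  {ae P, forall w, f n w @[n --> \oo] --> Y w} ->
  measurable_fun setT (Y : past_type t -> R).
Proof.
move=> mY mf [N [mN N0 badN]].
have pN : @measurable _ (past_type t) N by apply: sub_sigma_algebra; right.
rewrite -(setUv N); apply/measurable_funU => //; first exact: measurableC.
split.
  move=> _ B mB; apply: sub_sigma_algebra; right.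
  have mNB : measurable (N `&` Y @^-1` B).
    by apply: measurableI => //; rewrite -[X in measurable X]setTI; exact: mY.
  split => //; apply/eqP; rewrite eq_le measure_ge0 andbT -N0.
  by apply: le_measure; rewrite ?inE.
apply: (measurable_fun_cvg (h := fun n => f n : past_type t -> R)).
  by move=> n; exact: measurable_funTS.
by move=> w Nw; apply: contrapT => fw; apply: Nw; exact: badN.
Qed.

Lemma past_indep2 t (Y : Omega -> R) (g : S -> R) :
  measurable_fun setT (Y : past_type t -> R) -> measurable_fun setT g ->
  indep2 P Y (g \o eps (t + 1)).
Proof.
move=> mY mg A B mA mB; rewrite comp_preimage; apply: past_indep.
  by rewrite -[X in _ X]setTI; exact: mY.
by rewrite -[X in measurable X]setTI; exact: mg.
Qed.

End past.

(** * Second moments of martingale sums *)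

Section martingale_differences.
Context d (Omega : measurableType d) (R : realType) (P : probability Omega R).
Context d' (S : measurableType d') (eps : int -> Omega -> S).
Hypothesis meps : forall t, measurable_fun setT (eps t).
Hypothesis ieps : mutually_independent P eps.
Local Notation past_type t := (g_sigma_algebraType (past_gen P eps t)).

Context (Y : nat -> Omega -> R) (g : nat -> S -> R) (y z : R).
Hypothesis pY : forall t, measurable_fun setT (Y t : past_type t%:Z -> R).
Hypothesis mg : forall t, measurable_fun setT (g t).
Hypothesis iY : forall t, (\int[P]_w (Y t w ^+ 2)%:E <= y%:E)%E.
Hypothesis ig : forall t, (\int[P]_w (g t (eps t.+1%:Z w) ^+ 2)%:E <= z%:E)%E.
Hypothesis g0 : forall t, (\int[P]_w (g t (eps t.+1%:Z w))%:E = 0)%E.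

Let M n w := \sum_(1 <= t < n) Y t w * g t (eps t.+1%:Z w).
Let zeta t w := g t (eps t.+1%:Z w).

Let sqY t : sq_integrable P (Y t).
Proof.
by split; [exact: (past_measurable meps (@pY t))|exact: le_lt_trans (iY t) (ltry _)].
Qed.

Let mzeta t : measurable_fun setT (zeta t).
Proof. by apply: measurableT_comp. Qed.

Let sqzeta t : sq_integrable P (zeta t).
Proof. by split => //; exact: le_lt_trans (ig t) (ltry _). Qed.

Let integrable_sqr X : sq_integrable P X -> P.-integrable setT (fun w => (X w ^+ 2)%:E).
Proof. by move=> iX; under eq_fun do rewrite expr2; exact: sq_integrable_mul. Qed.

Let indepz t (X : Omega -> R) (h : R -> R) : measurable_fun setT h ->
  measurable_fun setT (X : past_type t%:Z -> R) -> indep2 P X (fun w => h (zeta t w)).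
Proof.
move=> mh pX; rewrite /zeta (_ : t.+1%:Z = t%:Z + 1); last by rewrite -addn1 PoszD.
by apply: (past_indep2 meps ieps (g := h \o g t)) => //; exact: measurableT_comp.
Qed.

(** Each increment is a past-measurable [Y t] times a centred variable independent of that past: in
    the square of the sum the cross term integrates to zero, and the square of the increment has
    mean at most y z. The induction has to carry along that the sum itself belongs to the past. *)
Lemma martingale_differences n : [/\ measurable_fun setT (M n : past_type n%:Z -> R),
  sq_integrable P (M n) & (\int[P]_w (M n w ^+ 2)%:E <= (n%:R * (y * z))%:E)%E].
Proof.
have y0 : 0 <= y.
  by rewrite -lee_fin (le_trans _ (iY 0))// integral_ge0// => w _; rewrite lee_fin sqr_ge0.
have z0 : 0 <= z.
  by rewrite -lee_fin (le_trans _ (ig 0))// integral_ge0// => w _; rewrite lee_fin sqr_ge0.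
have base k : (k <= 1)%N -> [/\ measurable_fun setT (M k : past_type k%:Z -> R),
  sq_integrable P (M k) & (\int[P]_w (M k w ^+ 2)%:E <= (k%:R * (y * z))%:E)%E].
  move=> k1; have -> : M k = fun=> 0.
    by apply/funext => w; rewrite /M big_geq.
  split; [exact: measurable_cst|exact: sq_integrable_cst|].
  under eq_integral do rewrite expr0n/=.
  by rewrite integral0 lee_fin !mulr_ge0.
elim: n => [|n [pM sM iM]]; first exact: base.
have [->|n0] := posnP n; first exact: base.
have ME : M n.+1 = fun w => M n w + Y n w * zeta n w.
  by apply/funext => w; rewrite /M big_nat_recr.
have pMY : measurable_fun setT ((fun w => M n w * Y n w) : past_type n%:Z -> R).
  by apply: measurable_funM => //; exact: pY.
(* Independence of the squares makes the product square integrable from second moments alone. *)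
have sqE : (\int[P]_w ((Y n w * zeta n w) ^+ 2)%:E =
    (\int[P]_w (Y n w ^+ 2)%:E) * \int[P]_w (zeta n w ^+ 2)%:E)%E.
  have pY2 : measurable_fun setT ((fun w => Y n w ^+ 2) : past_type n%:Z -> R).
    by apply: measurable_funX; exact: pY.
  have mX : measurable_fun setT (fun x : R => x ^+ 2) by exact: measurable_funX.
  have := indep2_expectation_abs (past_measurable meps pY2)
    (measurableT_comp mX (mzeta n)) (indepz mX pY2).
  under eq_integral do rewrite -exprMn ger0_norm ?sqr_ge0//.
  by move=> ->; congr (_ * _)%E; apply: eq_integral => w _; rewrite ger0_norm ?sqr_ge0.
have sqYz : sq_integrable P (fun w => Y n w * zeta n w).
  split; first by apply: measurable_funM => //; exact: (past_measurable meps (@pY n)).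
  rewrite sqE lte_mul_pinfty ?integral_ge0//.
  - by move=> w _; rewrite lee_fin sqr_ge0.
  - rewrite ge0_fin_numE; first exact: (sqY n).2.
    by apply: integral_ge0 => w _; rewrite lee_fin sqr_ge0.
  - exact: (sqzeta n).2.
have iMY := sq_integrable_mul sM (sqY n).
have iMYz := indep2_integrable (indepz (measurable_id (D := setT)) pMY) iMY
  (sq_integrable_integrable (sqzeta n)).
have iMYz0 := indep2_expectation0 (indepz (measurable_id (D := setT)) pMY) iMY
  (sq_integrable_integrable (sqzeta n)) (g0 n).
split; rewrite ME.
- apply: measurable_funD.
    by apply: past_type_mono pM; rewrite lez_nat.
  apply: measurable_funM.
    by apply: past_type_mono (@pY n); rewrite lez_nat.
  exact: past_eps.
- exact: sq_integrableD.
have iM2 := integrable_sqr sM; have iYz2 := integrable_sqr sqYz.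
under eq_integral => w _.
  rewrite (_ : _ ^+ 2 = M n w ^+ 2 + (Y n w * zeta n w) ^+ 2 +
    2 * (M n w * Y n w * zeta n w)); last by ring.
  rewrite 2!EFinD [(2 * _)%:E]EFinM; over.
rewrite integralD//; last 2 first.
- exact: integrableD.
- exact: integrableZl.
rewrite integralZl// iMYz0 mule0 adde0 integralD// sqE.
rewrite -natr1 mulrDl mul1r EFinD; apply: leeD => //.
rewrite EFinM; apply: lee_pmul; [..|exact: iY|exact: ig].
- by apply: integral_ge0 => w _; rewrite lee_fin sqr_ge0.
- by apply: integral_ge0 => w _; rewrite lee_fin sqr_ge0.
Qed.

End martingale_differences.

(** * Moments of the innovations and of the process *)

Section random_elements.
Context {R : realType} {V : preHilbertType R}.

Lemma continuous_borel_measurable (f : V -> R) : continuous f ->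
  measurable_fun setT (f : borel V -> R).
Proof.
move=> /continuousP cf; apply: (measurability _ (RGenOpens.measurableE R)).
move=> _ [_ [a [b ->] <-]]; rewrite setTI; apply: sub_sigma_algebra.
by apply: cf; exact: interval_open.
Qed.

Lemma inner_measurable h : measurable_fun setT (inner ^~ h : borel V -> R).
Proof.
apply: continuous_borel_measurable => x.
have -> : inner ^~ h = inner h by apply/funext => y; exact: innerC.
exact: inner_continuous.
Qed.

Lemma norm_measurable : measurable_fun setT ((fun x => `|x|) : borel V -> R).
Proof. by apply: continuous_borel_measurable; exact: norm_continuous. Qed.

Context d (Omega : measurableType d) (P : probability Omega R).

Lemma eq_law_ge0_integral d' (S : measurableType d') (X Y : Omega -> S)
  (mX : measurable_fun setT X) (mY : measurable_fun setT Y) :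
  (forall B, measurable B -> P (X @^-1` B) = P (Y @^-1` B)) ->
  forall f : S -> \bar R, measurable_fun setT f -> (forall x, (0 <= f x)%E) ->
  (\int[P]_w f (X w) = \int[P]_w f (Y w))%E.
Proof.
move=> XY f mf f0.
have push (Z : Omega -> S) (mZ : measurable_fun setT Z) :
    (\int[P]_w f (Z w) = \int[pushforward P Z]_x f x)%E.
  by rewrite ge0_integral_pushforward.
rewrite !push//; apply: eq_measure_integral => A mA _; exact: XY.
Qed.

Lemma eq_law_integral d' (S : measurableType d') (X Y : Omega -> S)
  (mX : measurable_fun setT X) (mY : measurable_fun setT Y) :
  (forall B, measurable B -> P (X @^-1` B) = P (Y @^-1` B)) ->
  forall f : S -> \bar R, measurable_fun setT f ->
  (\int[P]_w f (X w) = \int[P]_w f (Y w))%E.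
Proof.
move=> XY f mf; rewrite integralE [RHS]integralE; congr (_ - _)%E.
- have pE (T : Omega -> S) : (\int[P]_w (fun w => f (T w))^\+ w = \int[P]_w f^\+ (T w))%E.
    by apply: eq_integral => w _; rewrite !funeposE.
  rewrite !pE; exact: (eq_law_ge0_integral mX mY XY (measurable_funepos mf) (funepos_ge0 f)).
- have nE (T : Omega -> S) : (\int[P]_w (fun w => f (T w))^\- w = \int[P]_w f^\- (T w))%E.
    by apply: eq_integral => w _; rewrite !funenegE.
  rewrite !nE; exact: (eq_law_ge0_integral mX mY XY (measurable_funeneg mf) (funeneg_ge0 f)).
Qed.

Context (Z : Omega -> V).
Hypothesis mZ : measurable_fun setT (Z : Omega -> borel V).

Lemma measurable_norm_elt : measurable_fun setT (fun w => `|Z w|).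
Proof. exact: (measurableT_comp norm_measurable mZ). Qed.

Lemma measurable_inner_elt h : measurable_fun setT (fun w => inner (Z w) h).
Proof. exact: (measurableT_comp (inner_measurable h) mZ). Qed.

Lemma moment2_lty : finite_moment4 P Z -> (\int[P]_w (`|Z w| ^+ 2)%:E < +oo)%E.
Proof.
rewrite /finite_moment4 unlock => m4.
apply: (@le_lt_trans _ _ (\int[P]_w (1%:E + (`|Z w| ^+ 4)%:E))%E).
  apply: ge0_le_integral => //.
  - by apply/measurable_EFinP; apply: measurable_funX; exact: measurable_norm_elt.
  - apply/measurable_EFinP; apply: measurable_funD => //; apply: measurable_funX.
    exact: measurable_norm_elt.
  - move=> w _; rewrite -EFinD lee_fin (_ : 4%N = (2 * 2)%N)// exprM.
    by have := sqr_ge0 (`|Z w| ^+ 2 - 1); nra.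
rewrite ge0_integralD//; last first.
  by apply/measurable_EFinP; apply: measurable_funX; exact: measurable_norm_elt.
have [_ i1] := sq_integrable_cst P 1.
apply: lte_add_pinfty => //; apply: le_lt_trans i1.
by apply: ge0_le_integral => // w _; rewrite lee_fin expr1n.
Qed.

Context (m2 : R).
Hypothesis Zm2 : (\int[P]_w (`|Z w| ^+ 2)%:E = m2%:E)%E.

Lemma moment2_ge0 : 0 <= m2.
Proof. by rewrite -lee_fin -Zm2 integral_ge0// => w _; rewrite lee_fin exprn_ge0. Qed.

Let mZ2 : measurable_fun setT (fun w => (`|Z w| ^+ 2)%:E).
Proof. by apply/measurable_EFinP; apply: measurable_funX; exact: measurable_norm_elt. Qed.

Lemma inner_moment2_le h : (\int[P]_w (inner (Z w) h ^+ 2)%:E <= (m2 * `|h| ^+ 2)%:E)%E.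
Proof.
rewrite EFinM -Zm2 -ge0_integralZr//.
apply: ge0_le_integral => //.
- by move=> w _; rewrite lee_fin sqr_ge0.
- by apply/measurable_EFinP; apply: measurable_funX; exact: measurable_inner_elt.
- by apply: emeasurable_funM.
- move=> w _; rewrite -EFinM lee_fin -exprMn -real_normK ?num_real//.
  by rewrite lerXn2r ?nnegrE ?mulr_ge0// cauchy_schwarz.
Qed.

Lemma sq_integrable_inner h : sq_integrable P (fun w => inner (Z w) h).
Proof.
split; first exact: measurable_inner_elt.
by rewrite (le_lt_trans (inner_moment2_le h))// ltry.
Qed.

Lemma inner_moment_le g h :
  (\int[P]_w `|(inner (Z w) g * inner (Z w) h)%:E| <= (m2 * (`|g| * `|h|))%:E)%E.
Proof.
rewrite EFinM -Zm2 -ge0_integralZr//.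
apply: ge0_le_integral => //.
- apply: measurableT_comp => //; apply/measurable_EFinP.
  by apply: measurable_funM; exact: measurable_inner_elt.
- by apply: emeasurable_funM.
- move=> w _; rewrite -EFinM lee_fin normrM expr2 mulrACA.
  by rewrite ler_pM// cauchy_schwarz.
Qed.

(** Trace formula for the covariance: Parseval under the integral. *)
Lemma parseval_moment b : orthonormal_basis b ->
  (\sum_(k <oo) \int[P]_w (inner (Z w) (b k) ^+ 2)%:E = m2%:E)%E.
Proof.
move=> bb; rewrite -integral_nneseries//.
- rewrite -Zm2; apply: eq_integral => w _; rewrite -(parseval _ bb).
  by apply: eq_eseriesr => k _; rewrite innerC.
- by move=> k; apply/measurable_EFinP; apply: measurable_funX; exact: measurable_inner_elt.
- by move=> k w _; rewrite lee_fin sqr_ge0.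
Qed.

End random_elements.

Section double_series.
Context {R : realType} d (Omega : measurableType d) (P : probability Omega R).

Let msqr (F : Omega -> R) : measurable_fun setT F ->
  measurable_fun setT (fun w => (F w ^+ 2)%:E).
Proof. by move=> mF; apply/measurable_EFinP; exact: measurable_funX. Qed.

Lemma measurable_double_series (F : nat -> nat -> Omega -> R) :
  (forall k l, measurable_fun setT (F k l)) ->
  measurable_fun setT (fun w => \sum_(k <oo) \sum_(l <oo) (F k l w ^+ 2)%:E)%E.
Proof.
move=> mF; apply: (ge0_emeasurable_sum (P := xpredT)) => [k w _ _|k _].
  by apply: nneseries_ge0 => l _ _; rewrite lee_fin sqr_ge0.
apply: (ge0_emeasurable_sum (P := xpredT)) => [l w _ _|l _]; last exact: msqr.
by rewrite lee_fin sqr_ge0.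
Qed.

Lemma double_series_integral_le (F : nat -> nat -> Omega -> R) (c : nat -> nat -> R) :
  (forall k l, measurable_fun setT (F k l)) ->
  (forall k l, \int[P]_w (F k l w ^+ 2)%:E <= (c k l)%:E)%E ->
  (\int[P]_w (\sum_(k <oo) \sum_(l <oo) (F k l w ^+ 2)%:E) <=
   \sum_(k <oo) \sum_(l <oo) (c k l)%:E)%E.
Proof.
move=> mF Fc; rewrite integral_nneseries//; last 2 first.
- move=> k; apply: (ge0_emeasurable_sum (P := xpredT)) => [l w _ _|l _].
    by rewrite lee_fin sqr_ge0.
  exact: msqr.
- by move=> k w _; apply: nneseries_ge0 => l _ _; rewrite lee_fin sqr_ge0.
apply: lee_nneseries => [k _ _|k _].
  by apply: integral_ge0 => w _; apply: nneseries_ge0 => l _ _; rewrite lee_fin sqr_ge0.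
rewrite integral_nneseries//; last 2 first.
- by move=> l; exact: msqr.
- by move=> l w _; rewrite lee_fin sqr_ge0.
apply: lee_nneseries => [l _ _|l _]; last exact: Fc.
by apply: integral_ge0 => w _; rewrite lee_fin sqr_ge0.
Qed.

End double_series.

Section far1_moments.
Context {R : realType} {V : preHilbertType R}.
Context d (Omega : measurableType d) (P : probability Omega R).
Context (b : nat -> V) (Psi C0 : {linear V -> V}) (q : R) (eps X : int -> Omega -> V).
Hypothesis bb : orthonormal_basis b.
Hypothesis q01 : 0 <= q < 1.
Hypothesis Psiq : forall x, `|Psi x| <= q * `|x|.
Hypothesis hX : far1_causal_solution P Psi eps X.
Hypothesis hC0 : forall t, is_covariance_operator P (X t) C0.
Hypothesis heps : iid P (eps : int -> Omega -> borel V).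
Hypothesis heps0 : forall t, is_expectation P (eps t) 0.
Hypothesis heps4 : forall t, finite_moment4 P (eps t).
Hypothesis X4 : forall t, finite_moment4 P (X t).
Local Notation past_type t :=
  (g_sigma_algebraType (past_gen P (eps : int -> Omega -> borel V) t)).

Lemma measurable_far1 t : measurable_fun setT (X t : Omega -> borel V).
Proof. by case: hX. Qed.

Lemma measurable_innovation t : measurable_fun setT (eps t : Omega -> borel V).
Proof. by case: heps. Qed.

Let mX := measurable_far1.
Let meps := measurable_innovation.
Let ieps : mutually_independent P (eps : int -> Omega -> borel V).
Proof. by case: heps. Qed.

Let lawX t (B : set (borel V)) : measurable B -> P (X t @^-1` B) = P (X 0 @^-1` B).
Proof.
move=> mB; case: hX => _ stat _ _.
have := stat [:: 0] t (fun=> B) (fun=> mB).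
by rewrite set_cons1 !bigcap_set1 add0r.
Qed.

Let law_eps t (B : set (borel V)) : measurable B -> P (eps t @^-1` B) = P (eps 0 @^-1` B).
Proof. by case: heps => _ id_eps _; exact: id_eps. Qed.

Let mpow k : measurable_fun setT ((fun x => (`|x| ^+ k)%:E) : borel V -> \bar R).
Proof. by apply/measurable_EFinP; apply: measurable_funX; exact: norm_measurable. Qed.

Let mprod g h : measurable_fun setT ((fun x => (inner x g * inner x h)%:E) : borel V -> \bar R).
Proof. by apply/measurable_EFinP; apply: measurable_funM; exact: inner_measurable. Qed.

Definition far1_moment2 : R := fine (\int[P]_w (`|X 0 w| ^+ 2)%:E).
Definition innovation_moment2 : R := fine (\int[P]_w (`|eps 0 w| ^+ 2)%:E).
Definition innovation_moment4 : R := fine (\int[P]_w (`|eps 0 w| ^+ 4)%:E).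
Local Notation tX := far1_moment2.
Local Notation s2 := innovation_moment2.
Local Notation s4 := innovation_moment4.

Lemma far1_moment2E t : (\int[P]_w (`|X t w| ^+ 2)%:E = tX%:E)%E.
Proof.
have h0 w : (0 <= (`|X 0 w| ^+ 2)%:E)%E by rewrite lee_fin exprn_ge0.
rewrite fineK; last by rewrite ge0_fin_numE ?integral_ge0// moment2_lty.
apply: (eq_law_ge0_integral (mX t) (mX 0) (lawX t) (mpow 2)) => x.
by rewrite lee_fin exprn_ge0.
Qed.

Lemma innovation_moment2E t : (\int[P]_w (`|eps t w| ^+ 2)%:E = s2%:E)%E.
Proof.
have h0 w : (0 <= (`|eps 0 w| ^+ 2)%:E)%E by rewrite lee_fin exprn_ge0.
rewrite fineK; last by rewrite ge0_fin_numE ?integral_ge0// moment2_lty.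
apply: (eq_law_ge0_integral (meps t) (meps 0) (law_eps t) (mpow 2)) => x.
by rewrite lee_fin exprn_ge0.
Qed.

Lemma innovation_moment4E t : (\int[P]_w (`|eps t w| ^+ 4)%:E = s4%:E)%E.
Proof.
have h0 w : (0 <= (`|eps 0 w| ^+ 4)%:E)%E by rewrite lee_fin exprn_ge0.
rewrite fineK; last first.
  by rewrite ge0_fin_numE ?integral_ge0//; have := heps4 0; rewrite /finite_moment4 unlock.
apply: (eq_law_ge0_integral (meps t) (meps 0) (law_eps t) (mpow 4)) => x.
by rewrite lee_fin exprn_ge0.
Qed.

Lemma covariance_operatorE t g h :
  (\int[P]_w (inner (X t w) g * inner (X t w) h)%:E = (inner (C0 g) h)%:E)%E.
Proof.
have [_ /(_ h)] := hC0 t g; rewrite unlock => <-.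
by apply: eq_integral => w _; rewrite /tensor innerZl.
Qed.

Lemma covariance_operator_sym g h : inner (C0 g) h = inner g (C0 h).
Proof.
apply: EFin_inj; rewrite (innerC g) -!(covariance_operatorE 0).
by apply: eq_integral => w _; rewrite mulrC.
Qed.

Let abs_fin_le (r s : R) (f : Omega -> R) : (\int[P]_w (f w)%:E = r%:E)%E ->
  measurable_fun setT f -> (\int[P]_w `|(f w)%:E| <= s%:E)%E -> `|r| <= s.
Proof.
move=> fr mf fs; rewrite -lee_fin (le_trans _ fs)// -abse_EFin -fr.
by apply: le_abse_integral => //; exact/measurable_EFinP.
Qed.

Lemma covariance_operator_bound g : `|C0 g| <= tX * `|g|.
Proof.
have t0 := moment2_ge0 (far1_moment2E 0).
apply: norm_le_inner => [|h]; first by rewrite mulr_ge0.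
rewrite -mulrA; apply: (abs_fin_le (covariance_operatorE 0 g h)).
  by apply: measurable_funM; exact: measurable_inner_elt.
exact: (inner_moment_le (mX 0) (far1_moment2E 0)).
Qed.

(** Kept as a bilinear form, since without completeness no operator need represent it. *)
Definition innovation_cov g h : R := fine (\int[P]_w (inner (eps 0 w) g * inner (eps 0 w) h)%:E).
Local Notation cc := innovation_cov.

Let integrable_eps2 t g h :
  P.-integrable setT (fun w => (inner (eps t w) g * inner (eps t w) h)%:E).
Proof.
by apply: sq_integrable_mul; exact: (sq_integrable_inner (meps t) (innovation_moment2E t)).
Qed.

Lemma innovation_covE t g h :
  (\int[P]_w (inner (eps t w) g * inner (eps t w) h)%:E = (cc g h)%:E)%E.
Proof.
rewrite fineK; last exact: (integrable_fin_num measurableT (integrable_eps2 0 g h)).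
exact: (eq_law_integral (meps t) (meps 0) (law_eps t) (mprod g h)).
Qed.

Lemma innovation_cov_sym g h : cc g h = cc h g.
Proof. by congr fine; apply: eq_integral => w _; rewrite mulrC. Qed.

Lemma innovation_cov_linear h : scalar (cc^~ h).
Proof.
move=> a g g' /=; apply: EFin_inj; rewrite EFinD EFinM -!(innovation_covE 0).
rewrite -integralZl//= -integralD//=; last exact: integrableZl.
apply: eq_integral => w _; rewrite -EFinM -EFinD inner_is_scalar/=; congr EFin.
ring.
Qed.

Lemma innovation_cov_bound g h : `|cc g h| <= s2 * `|g| * `|h|.
Proof.
rewrite -mulrA; apply: (abs_fin_le (innovation_covE 0 g h)).
  by apply: measurable_funM; exact: measurable_inner_elt.
exact: (inner_moment_le (meps 0) (innovation_moment2E 0)).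
Qed.

Lemma innovation_mean t h : (\int[P]_w (inner (eps t w) h)%:E = 0)%E.
Proof. by have [_ /(_ h)] := heps0 t; rewrite unlock innerC raddf0. Qed.

Let Psi_cts : continuous Psi. Proof. exact: (bounded_additive_continuous Psiq). Qed.

(** A coordinate of X_t is almost surely the limit of the partial sums of the causal series, which
    involve only eps_s with s <= t. *)
Lemma far1_past t h :
  measurable_fun setT ((fun w => inner (X t w) h) : past_type t -> R).
Proof.
pose f (J : nat) w := \sum_(0 <= j < J) inner (iter j Psi (eps (t - j%:Z) w)) h.
apply: (past_ae_limit (f := f)).
- exact: measurable_inner_elt.
- move=> J; apply: measurable_sum => j.
  apply: (@past_eps _ Omega R P _ (borel V) eps (t - j%:Z) t (fun v : V => inner (iter j Psi v) h)).
    by rewrite lerBlDr lerDl.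
  apply: continuous_borel_measurable => v.
  have -> : (fun v => inner (iter j Psi v) h) = inner h \o iter j Psi.
    by apply/funext => y; exact: innerC.
  apply: continuous_comp; last exact: inner_continuous.
  elim: j => [|j IH] /=; first exact: cvg_id.
  by apply: continuous_comp; [exact: IH|exact: Psi_cts].
case: hX => _ _ _ /(_ t); apply: filterS => w lim.
have := @cvg_inner _ _ _ _ h lim; rewrite innerC; apply: cvg_trans.
apply: near_eq_cvg; near=> J.
by rewrite /f /series/= linear_sum; apply: eq_bigr => j _; rewrite innerC.
Unshelve. all: by end_near. Qed.

Let Riesz g J := riesz_sum b (inner g \o Psi) J.

Let p g w := inner g (Psi (X 0 w)).

(** [far1_past] covers <X_0, h> for a fixed h; <g, Psi X_0> is the limit of such coordinates along
    the truncations of Psi^* g. *)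
Let past_p g : measurable_fun setT (p g : past_type 0 -> R).
Proof.
apply: (past_ae_limit (f := fun J w => inner (X 0 w) (Riesz g J))).
- rewrite /p; under eq_fun do rewrite innerC.
  apply: (measurableT_comp (f := (fun x => inner (Psi x) g) : borel V -> R)) => //.
  apply: continuous_borel_measurable => v.
  have -> : (fun v => inner (Psi v) g) = inner g \o Psi.
    by apply/funext => y; exact: innerC.
  by apply: continuous_comp; [exact: Psi_cts|exact: inner_continuous].
- by move=> J; exact: far1_past.
- by apply: aeW => w; exact: cvg_riesz_sum_comp.
Qed.

Let sq_p g : sq_integrable P (p g).
Proof.
have mp := past_measurable meps (@past_p g); split => //.
have t0 := moment2_ge0 (far1_moment2E 0).
apply: (@le_lt_trans _ _ (((`|g| * q) ^+ 2)%:E * tX%:E)%E); last by rewrite -EFinM ltry.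
rewrite -(far1_moment2E 0) -ge0_integralZl//; last 2 first.
- by apply/measurable_EFinP; apply: measurable_funX; exact: measurable_norm_elt.
- by rewrite lee_fin sqr_ge0.
apply: ge0_le_integral => //.
- by move=> w _; rewrite lee_fin sqr_ge0.
- by apply/measurable_EFinP; apply: measurable_funX.
- apply: emeasurable_funM => //; apply/measurable_EFinP; apply: measurable_funX.
  exact: measurable_norm_elt.
- move=> w _; rewrite -EFinM lee_fin -exprMn -real_normK ?num_real//.
  have [q0 _] := andP q01.
  rewrite lerXn2r ?nnegrE ?mulr_ge0// (le_trans (cauchy_schwarz _ _))//.
  by rewrite -mulrA ler_wpM2l.
Qed.

Let sq_e h : sq_integrable P (fun w => inner (eps 1 w) h).
Proof. exact: (sq_integrable_inner (meps 1) (innovation_moment2E 1)). Qed.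

Let cross g h : (\int[P]_w (p g w * inner (eps 1 w) h)%:E = 0)%E.
Proof.
apply: indep2_expectation0.
- have := @past_indep2 _ _ _ P _ (borel V) eps meps ieps 0 (p g) (inner ^~ h)
    (@past_p g) (inner_measurable h).
  by rewrite add0r.
- exact: sq_integrable_integrable.
- exact: sq_integrable_integrable.
- exact: innovation_mean.
Qed.

(** Expansion of the covariance at time 1 by X_1 = Psi X_0 + eps_1. The mixed terms vanish since
    eps_1 is centred and independent of the past, and [C0] is the covariance operator at every
    time. *)
Let second_moment_Psi g h :
  (\int[P]_w (p g w * p h w)%:E = (inner (C0 g) h - cc g h)%:E)%E.
Proof.
have H1 := sq_integrable_mul (sq_p g) (sq_p h).
have H2 := sq_integrable_mul (sq_p g) (sq_e h).
have H3 := sq_integrable_mul (sq_p h) (sq_e g).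
have H4 := integrable_eps2 1 g h.
have E : (\int[P]_w (inner (X 1 w) g * inner (X 1 w) h)%:E =
    \int[P]_w ((p g w * p h w)%:E + ((p g w * inner (eps 1 w) h)%:E +
      ((p h w * inner (eps 1 w) g)%:E + (inner (eps 1 w) g * inner (eps 1 w) h)%:E))))%E.
  apply: ae_eq_integral => //.
  - by apply/measurable_EFinP; apply: measurable_funM; exact: measurable_inner_elt.
  - apply: emeasurable_funD; first exact: measurable_int H1.
    apply: emeasurable_funD; first exact: measurable_int H2.
    by apply: emeasurable_funD; [exact: measurable_int H3|exact: measurable_int H4].
  - case: hX => _ _ /(_ 1) + _; apply: filterS => w /= -> _.
    rewrite subrr !innerDl -!EFinD /p !(innerC (Psi _)); congr EFin.
    ring.
move: E; rewrite covariance_operatorE integralD//=; last first.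
  by apply: integrableD => //; exact: integrableD.
rewrite integralD//; last exact: integrableD.
rewrite integralD// !cross !add0e innovation_covE => E.
by rewrite EFinB E addeK.
Qed.

(** Under the integral the truncations act on X_0, where they converge pointwise to <g, Psi X_0>;
    the products are dominated by q^2 |g| |h| |X_0|^2. *)
Lemma covariance_operator_limit g h :
  inner (C0 (riesz_sum b (inner g \o Psi) J)) (riesz_sum b (inner h \o Psi) J)
    @[J --> \oo] --> inner (C0 g) h - cc g h.
Proof.
have [q0 _] := andP q01.
pose f J w := (inner (X 0 w) (Riesz g J) * inner (X 0 w) (Riesz h J))%:E.
have lim : (\int[P]_w f J w @[J --> \oo] --> \int[P]_w (p g w * p h w)%:E)%E.
  apply: (@dominated_cvg _ _ _ P setT measurableT f _
    (fun w => (`|X 0 w| ^+ 2 * (q * `|g| * (q * `|h|)))%:E)) => //.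
  - move=> J; apply/measurable_EFinP.
    by apply: measurable_funM; exact: measurable_inner_elt.
  - by move=> w _; apply: cvg_EFin; [exact: nearW|apply: cvgM; exact: cvg_riesz_sum_comp].
  - apply/integrableP; split.
      apply/measurable_EFinP; apply: measurable_funM => //.
      by apply: measurable_funX; exact: measurable_norm_elt.
    under eq_integral => w _ do rewrite gee0_abs ?lee_fin ?mulr_ge0 ?exprn_ge0// EFinM.
    rewrite ge0_integralZr//; first by rewrite far1_moment2E -EFinM ltry.
    + by apply/measurable_EFinP; apply: measurable_funX; exact: measurable_norm_elt.
    + by rewrite lee_fin !mulr_ge0.
  - move=> J w _; rewrite lee_fin normrM expr2 mulrACA.
    by rewrite ler_pM// (le_trans (cauchy_schwarz _ _))// ler_wpM2l// norm_riesz_sum_comp.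
move: lim; rewrite second_moment_Psi => /fine_cvg.
by apply: cvg_trans; apply: near_eq_cvg; near=> J; rewrite /= covariance_operatorE.
Unshelve. all: by end_near. Qed.

Let y k := inner (C0 (b k)) (b k).
Let z l := cc (b l) (b l).

Let yE t k : (\int[P]_w (inner (X t w) (b k) ^+ 2)%:E = (y k)%:E)%E.
Proof. by under eq_integral do rewrite expr2; exact: covariance_operatorE. Qed.

Let zE t l : (\int[P]_w (inner (eps t w) (b l) ^+ 2)%:E = (z l)%:E)%E.
Proof. by under eq_integral do rewrite expr2; exact: innovation_covE. Qed.

Let y0 k : 0 <= y k.
Proof. by rewrite -lee_fin -(yE 0) integral_ge0// => w _; rewrite lee_fin sqr_ge0. Qed.

Let z0 l : 0 <= z l.
Proof. by rewrite -lee_fin -(zE 0) integral_ge0// => w _; rewrite lee_fin sqr_ge0. Qed.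

Let sum_y : (\sum_(k <oo) (y k)%:E = tX%:E)%E.
Proof.
rewrite -(parseval_moment (mX 0) (far1_moment2E 0) bb).
by apply: eq_eseriesr => k _; rewrite yE.
Qed.

Let sum_z : (\sum_(l <oo) (z l)%:E = s2%:E)%E.
Proof.
rewrite -(parseval_moment (meps 0) (innovation_moment2E 0) bb).
by apply: eq_eseriesr => k _; rewrite zE.
Qed.

Let int1 : (\int[P]_w (1 ^+ 2 : R)%:E <= 1%:E)%E.
Proof. by have := expectation_cst P (1 ^+ 2 : R); rewrite unlock expr1n => ->. Qed.

(** Each coordinate is a martingale sum with constant predictable factor 1, written out below to
    match [martingale_differences]; the coordinate variances add up to the trace. *)
Lemma innovation_sum_moment n :
  (\int[P]_w (`|\sum_(1 <= t < n) eps t.+1%:Z w| ^+ 2)%:E <= (n%:R * s2)%:E)%E.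
Proof.
pose F k w : R := \sum_(1 <= t < n) 1 * inner (eps t.+1%:Z w) (b k).
have FE k : measurable_fun setT (F k) /\ (\int[P]_w (F k w ^+ 2)%:E <= (n%:R * z k)%:E)%E.
  have [_ [mF _] iF] := @martingale_differences _ _ _ P _ (borel V) eps meps ieps
    (fun _ _ => 1) (fun _ => inner ^~ (b k)) 1 (z k)
    (fun _ => measurable_cst _) (fun _ => inner_measurable _)
    (fun _ => int1)
    (fun t => ltac:(by rewrite zE)) (fun t => innovation_mean t.+1%:Z (b k)) n.
  by rewrite mul1r in iF.
rewrite (eq_integral (fun w => \sum_(k <oo) (F k w ^+ 2)%:E)%E); last first.
  move=> w _; rewrite -(parseval _ bb); apply: eq_eseriesr => k _.
  by rewrite linear_sum; congr ((_ ^+ 2)%:E); apply: eq_bigr => t _; rewrite mul1r innerC.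
rewrite integral_nneseries//; last 2 first.
- by move=> k; apply/measurable_EFinP; apply: measurable_funX; case: (FE k).
- by move=> k w _; rewrite lee_fin sqr_ge0.
rewrite EFinM -sum_z -nneseriesZl; last by move=> k _; rewrite lee_fin.
apply: lee_nneseries => [k _ _|k _]; last by rewrite -EFinM; case: (FE k).
by apply: integral_ge0 => w _; rewrite lee_fin sqr_ge0.
Qed.

(** The (k, l) coefficient is a martingale sum with second moment at most n y_k z_l, and the double
    sum of y_k z_l factors into the two traces. *)
Lemma cross_sum_moment n :
  (\int[P]_w hs2 b (fun v => \sum_(1 <= t < n) tensor (eps t.+1%:Z w) (X t%:Z w) v)%R <=
   (n%:R * (tX * s2))%:E)%E.
Proof.
pose F k l w : R := \sum_(1 <= t < n) inner (X t%:Z w) (b k) * inner (eps t.+1%:Z w) (b l).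
have FE k l : measurable_fun setT (F k l) /\
    (\int[P]_w (F k l w ^+ 2)%:E <= (n%:R * (y k * z l))%:E)%E.
  have [_ [mF _] iF] := @martingale_differences _ _ _ P _ (borel V) eps meps ieps
    (fun t w => inner (X t%:Z w) (b k)) (fun _ => inner ^~ (b l)) (y k) (z l)
    (fun t => @far1_past t%:Z (b k)) (fun _ => inner_measurable _)
    (fun t => ltac:(by rewrite yE)) (fun t => ltac:(by rewrite zE))
    (fun t => innovation_mean t.+1%:Z (b l)) n.
  by [].
rewrite (eq_integral (fun w => \sum_(k <oo) \sum_(l <oo) (F k l w ^+ 2)%:E)%E); last first.
  move=> w _; apply: eq_eseriesr => k _; rewrite -(parseval _ bb).
  apply: eq_eseriesr => l _; rewrite linear_sum; congr ((_ ^+ 2)%:E).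
  by apply: eq_bigr => t _; rewrite /= /tensor innerZr (innerC (b l)).
apply: (le_trans (double_series_integral_le (fun k l => (FE k l).1) (fun k l => (FE k l).2))).
rewrite (eq_eseriesr (g := fun k => (n%:R * s2)%:E * (y k)%:E)%E); last first.
  move=> k _; rewrite -muleC EFinM -sum_z muleA -EFinM -nneseriesZl; last first.
    by move=> l _; rewrite lee_fin.
  by apply: eq_eseriesr => l _; rewrite -EFinM; congr EFin; ring.
rewrite nneseriesZl; last by move=> k _; rewrite lee_fin.
by rewrite sum_y -EFinM lee_fin -mulrA (mulrC s2).
Qed.

Let z2 k l := fine (\int[P]_w ((inner (eps 0 w) (b k) * inner (eps 0 w) (b l)) ^+ 2)%:E).

Let mprod_eps t k l : measurable_fun setT
  (fun w => ((inner (eps t w) (b k) * inner (eps t w) (b l)) ^+ 2)%:E).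
Proof.
apply/measurable_EFinP; apply: measurable_funX.
by apply: measurable_funM; exact: measurable_inner_elt.
Qed.

(** Parseval in both indices: the Hilbert-Schmidt norm of the tensor square of eps_t is
    |eps_t|^2. *)
Let sum_sqr t w : (\sum_(k <oo) \sum_(l <oo)
  ((inner (eps t w) (b k) * inner (eps t w) (b l)) ^+ 2)%:E = (`|eps t w| ^+ 4)%:E)%E.
Proof.
rewrite (eq_eseriesr (g := fun k => (`|eps t w| ^+ 2)%:E * (inner (b k) (eps t w) ^+ 2)%:E)%E).
  by rewrite nneseriesZl ?parseval// => [|k _]; rewrite ?lee_fin ?sqr_ge0// -EFinM -exprD.
move=> k _; rewrite muleC -(parseval (eps t w) bb) -nneseriesZl; last first.
  by move=> l _; rewrite lee_fin sqr_ge0.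
by apply: eq_eseriesr => l _; rewrite -EFinM exprMn !(innerC (b _)).
Qed.

Let int_sqr_lty t k l :
  (\int[P]_w ((inner (eps t w) (b k) * inner (eps t w) (b l)) ^+ 2)%:E < +oo)%E.
Proof.
apply: (@le_lt_trans _ _ (s4%:E)); last exact: ltry.
rewrite -(innovation_moment4E t); apply: ge0_le_integral => //.
- by move=> w _; rewrite lee_fin sqr_ge0.
- by apply/measurable_EFinP; apply: measurable_funX; exact: measurable_norm_elt.
- have [bo _] := bb.
  have nb j : `|b j| = 1.
    apply/eqP; rewrite -(@eqrXn2 _ 2)// -innerff bo eqxx expr1n//.
  have le j w : `|inner (eps t w) (b j)| <= `|eps t w|.
    by rewrite (le_trans (cauchy_schwarz _ _))// nb mulr1.
  move=> w _; rewrite lee_fin exprMn (_ : 4%N = (2 + 2)%N)// exprD.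
  rewrite -[X in X * _]real_normK ?num_real// -[X in _ * X <= _]real_normK ?num_real//.
  by rewrite ler_pM ?exprn_ge0// lerXn2r ?nnegrE.
Qed.

Let z2E t k l :
  (\int[P]_w ((inner (eps t w) (b k) * inner (eps t w) (b l)) ^+ 2)%:E = (z2 k l)%:E)%E.
Proof.
rewrite fineK; last first.
  by rewrite ge0_fin_numE ?int_sqr_lty// integral_ge0// => w _; rewrite lee_fin sqr_ge0.
apply: (eq_law_ge0_integral (meps t) (meps 0) (law_eps t)
  (f := fun x => ((inner x (b k) * inner x (b l)) ^+ 2)%:E)) => [|x].
  apply/measurable_EFinP; apply: measurable_funX.
  by apply: measurable_funM; exact: inner_measurable.
by rewrite lee_fin sqr_ge0.
Qed.

Let sum_z2 : (\sum_(k <oo) \sum_(l <oo) (z2 k l)%:E = s4%:E)%E.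
Proof.
rewrite -(innovation_moment4E 0).
under eq_integral do rewrite -sum_sqr.
rewrite integral_nneseries//; last 2 first.
- move=> k; apply: (ge0_emeasurable_sum (P := xpredT)) => [l w _ _|l _//].
  by rewrite lee_fin sqr_ge0.
- by move=> k w _; apply: nneseries_ge0 => l _ _; rewrite lee_fin sqr_ge0.
apply: eq_eseriesr => k _; rewrite integral_nneseries//; last first.
  by move=> l w _; rewrite lee_fin sqr_ge0.
by apply: eq_eseriesr => l _; rewrite z2E.
Qed.

(** The coefficients of the tensor square of eps_t, minus their means, have variance at most the raw
    second moment [z2]; the double sum of the latter is the fourth moment of the innovation. *)
Lemma cov_sum_moment n :
  (\int[P]_w (\sum_(k <oo) \sum_(l <oo) ((\sum_(1 <= t < n)
     (inner (eps t.+1%:Z w) (b k) * inner (eps t.+1%:Z w) (b l) - cc (b k) (b l))) ^+ 2)%:E) <=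
   (n%:R * s4)%:E)%E.
Proof.
pose F k l w : R := \sum_(1 <= t < n)
  1 * (inner (eps t.+1%:Z w) (b k) * inner (eps t.+1%:Z w) (b l) - cc (b k) (b l)).
have centered_moment t k l : (\int[P]_w
   ((inner (eps t w) (b k) * inner (eps t w) (b l) - cc (b k) (b l)) ^+ 2)%:E <= (z2 k l)%:E)%E.
  set c := cc (b k) (b l).
  pose f w := inner (eps t w) (b k) * inner (eps t w) (b l).
  have if2 : P.-integrable setT (fun w => (f w ^+ 2)%:E).
    apply/integrableP; split; first exact: mprod_eps.
    under eq_integral do rewrite gee0_abs ?lee_fin ?sqr_ge0//.
    exact: int_sqr_lty.
  have if1 : P.-integrable setT (fun w => (f w)%:E) by exact: integrable_eps2.
  have ic : P.-integrable setT (fun w : Omega => (c ^+ 2)%:E).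
    exact: (sq_integrable_integrable (sq_integrable_cst P (c ^+ 2))).
  rewrite (eq_integral
    (fun w => (f w ^+ 2)%:E + ((- 2 * c)%:E * (f w)%:E + (c ^+ 2)%:E))%E); last first.
    by move=> w _; rewrite -EFinM -!EFinD -/(f w); congr EFin; ring.
  rewrite integralD//; last by apply: integrableD => //; exact: integrableZl.
  rewrite integralD//; last exact: integrableZl.
  rewrite integralZl// z2E innovation_covE -/c.
  have := expectation_cst P (c ^+ 2); rewrite unlock => ->.
  rewrite -EFinM -!EFinD lee_fin; have := sqr_ge0 c; nra.
have centered_mean t k l : (\int[P]_w
   (inner (eps t w) (b k) * inner (eps t w) (b l) - cc (b k) (b l))%:E = 0)%E.
  under eq_integral do rewrite EFinB.
  rewrite integralB//; last first.
    exact: (sq_integrable_integrable (sq_integrable_cst P _)).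
  rewrite innovation_covE; have := expectation_cst P (cc (b k) (b l)); rewrite unlock => ->.
  by rewrite -EFinB subrr.
have FE k l : measurable_fun setT (F k l) /\
    (\int[P]_w (F k l w ^+ 2)%:E <= (n%:R * z2 k l)%:E)%E.
  have mg : measurable_fun setT
      ((fun x => inner x (b k) * inner x (b l) - cc (b k) (b l)) : borel V -> R).
    apply: measurable_funB => //; apply: measurable_funM; exact: inner_measurable.
  have [_ [mF _] iF] := @martingale_differences _ _ _ P _ (borel V) eps meps ieps
    (fun _ _ => 1) (fun _ x => inner x (b k) * inner x (b l) - cc (b k) (b l)) 1 (z2 k l)
    (fun _ => measurable_cst _) (fun _ => mg) (fun _ => int1)
    (fun t => centered_moment t.+1%:Z k l) (fun t => centered_mean t.+1%:Z k l) n.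
  by rewrite mul1r in iF.
rewrite (eq_integral (fun w => \sum_(k <oo) \sum_(l <oo) (F k l w ^+ 2)%:E)%E); last first.
  move=> w _; apply: eq_eseriesr => k _; apply: eq_eseriesr => l _; congr ((_ ^+ 2)%:E).
  by apply: eq_bigr => t _; rewrite mul1r.
apply: (le_trans (double_series_integral_le (fun k l => (FE k l).1) (fun k l => (FE k l).2))).
have z20 k l : (0 <= (z2 k l)%:E)%E.
  by rewrite -(z2E 0) integral_ge0// => w _; rewrite lee_fin sqr_ge0.
rewrite EFinM -sum_z2 -nneseriesZl; last by move=> k _; exact: nneseries_ge0.
apply: lee_nneseries => [k _ _|k _].
  by apply: nneseries_ge0 => l _ _; rewrite EFinM mule_ge0.
by rewrite -nneseriesZl; last by move=> l _; exact: z20.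
Qed.

Lemma measurable_innovation_sum n :
  measurable_fun setT (fun w => (`|\sum_(1 <= t < n) eps t.+1%:Z w| ^+ 2)%:E).
Proof.
pose F k w : R := \sum_(1 <= t < n) inner (eps t.+1%:Z w) (b k).
rewrite (_ : (fun w => _) = fun w => (\sum_(k <oo) (F k w ^+ 2)%:E)%E).
  apply: (ge0_emeasurable_sum (P := xpredT)) => [k w _ _|k _].
    by rewrite lee_fin sqr_ge0.
  apply/measurable_EFinP; apply: measurable_funX; apply: measurable_sum => t.
  exact: measurable_inner_elt.
apply/funext => w; rewrite -(parseval _ bb); apply: eq_eseriesr => k _.
by rewrite linear_sum; congr ((_ ^+ 2)%:E); apply: eq_bigr => t _; rewrite innerC.
Qed.

Lemma measurable_cross_sum n : measurable_fun setT (fun w =>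
  hs2 b (fun v => \sum_(1 <= t < n) tensor (eps t.+1%:Z w) (X t%:Z w) v)%R).
Proof.
pose F k l w : R := \sum_(1 <= t < n) inner (X t%:Z w) (b k) * inner (eps t.+1%:Z w) (b l).
rewrite (_ : (fun w => _) = fun w => (\sum_(k <oo) \sum_(l <oo) (F k l w ^+ 2)%:E)%E).
  apply: measurable_double_series => k l; apply: measurable_sum => t.
  by apply: measurable_funM; exact: measurable_inner_elt.
apply/funext => w; apply: eq_eseriesr => k _; rewrite -(parseval _ bb).
apply: eq_eseriesr => l _; rewrite linear_sum; congr ((_ ^+ 2)%:E).
by apply: eq_bigr => t _; rewrite /= /tensor innerZr (innerC (b l)).
Qed.

Lemma measurable_cov_sum n : measurable_fun setT (fun w =>
  \sum_(k <oo) \sum_(l <oo) ((\sum_(1 <= t < n)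
     (inner (eps t.+1%:Z w) (b k) * inner (eps t.+1%:Z w) (b l) - cc (b k) (b l))) ^+ 2)%:E)%E.
Proof.
apply: (measurable_double_series (F := fun k l w => \sum_(1 <= t < n)
  (inner (eps t.+1%:Z w) (b k) * inner (eps t.+1%:Z w) (b l) - cc (b k) (b l)))) => k l.
apply: measurable_sum => t; apply: measurable_funB => //.
by apply: measurable_funM; exact: measurable_inner_elt.
Qed.

End far1_moments.

(** * Rate of convergence *)

Section error_rate_arith.
Context {R : realType}.

Let sqr_le (v w : R) : 0 <= v -> v <= w -> v ^+ 2 <= w ^+ 2.
Proof. by move=> v0 vw; rewrite lerXn2r// nnegrE// (le_trans v0). Qed.

(* Used with [N = n], [k = 1 / (n - 1)], [u] the order of [al = alpha_n] and
   [r] the rate. *)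
Lemma error_rate_arith (u r N k al c C s H NC L CC HF : R) :
  0 < u -> u <= 1 -> 0 < r -> r <= 1 -> 0 < N -> (r * u) ^+ 2 * N = 1 ->
  0 <= k -> k * N <= 2 -> 0 < c -> c * u <= al -> al <= C * u -> u `^ s = r -> 0 <= s ->
  0 <= H -> 0 <= NC -> 0 <= L -> 0 <= CC -> 0 <= HF ->
  3 * (k ^+ 2 * 4 * H + k ^+ 2 * al^-1 ^+ 2 * (NC * N) +
    (L * al `^ s * (1 + CC / Num.sqrt N / al)) ^+ 2 * HF) <=
  3 * (16 * H + 4 * NC / c ^+ 2 + (L * C `^ s * (1 + CC / c)) ^+ 2 * HF) * r ^+ 2.
Proof.
move=> u0 u1 r0 r1 N0 ruN k0 kN c0 cal alC us s0 H0 NC0 L0 CC0 HF0.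
have cu0 : 0 < c * u by rewrite mulr_gt0.
have al0 : 0 < al by exact: lt_le_trans cal.
have C0 : 0 < C by rewrite -(pmulr_lgt0 _ u0) (lt_le_trans al0).
have k2 : k <= 2 * (r * u) ^+ 2.
  by rewrite -(ler_pM2r N0) -mulrA ruN mulr1.
have kle : k ^+ 2 <= (2 * (r * u) ^+ 2) ^+ 2.
  exact: sqr_le.
have ru1 : (r * u) ^+ 2 <= 1 by rewrite exprn_ile1 ?mulr_ile1// ltW// mulr_gt0.
have ru0 : 0 <= (r * u) ^+ 2 by rewrite sqr_ge0.
have rur : (r * u) ^+ 2 <= r ^+ 2.
  by rewrite exprMn ler_piMr ?sqr_ge0// exprn_ile1// ltW.
have T1 : k ^+ 2 * 4 * H <= 16 * H * r ^+ 2.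
  rewrite mulrAC -[leRHS]mulrA [H * _]mulrC mulrA -[leLHS]mulrA [H * 4]mulrC mulrA.
  rewrite ler_wpM2r//; move: kle ru1 ru0 rur (sqr_ge0 r).
  set p := (r * u) ^+ 2; set r2 := r ^+ 2 => kle ru1 ru0 rur _.
  by apply: (@le_trans _ _ ((2 * p) ^+ 2 * 4)); [lra|nra].
have iac : al^-1 ^+ 2 <= (c * u)^-1 ^+ 2.
  by apply: sqr_le; [rewrite invr_ge0 ltW|rewrite lef_pV2].
have T2 : k ^+ 2 * al^-1 ^+ 2 * (NC * N) <= 4 * NC / c ^+ 2 * r ^+ 2.
  apply: (@le_trans _ _ ((2 * (r * u) ^+ 2) ^+ 2 * (c * u)^-1 ^+ 2 * (NC * N))).
    rewrite ler_wpM2r ?mulr_ge0 ?(ltW N0)//.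
    by apply: ler_pM => //; exact: sqr_ge0.
  have -> : N = (r * u) ^- 2 by rewrite -[RHS]mulr1 -ruN mulKf// lt0r_neq0// exprn_gt0// mulr_gt0.
  rewrite le_eqVlt; apply/orP; left; apply/eqP; field.
  by rewrite !lt0r_neq0.
(* Dividing r u by [al] >= c u leaves at most r / c <= 1 / c, which bounds the factor coming from
   the covariance deviation. *)
have sN : (Num.sqrt N)^-1 = r * u.
  have sN0 : 0 < Num.sqrt N by rewrite sqrtr_gt0.
  apply: (mulIf (lt0r_neq0 sN0)); rewrite mulVf ?lt0r_neq0//.
  apply/eqP; rewrite eq_sym -(@eqrXn2 _ 2)// ?mulr_ge0 ?(ltW sN0) ?ltW ?mulr_gt0//.
  by rewrite expr1n exprMn sqr_sqrtr ?ruN// ltW.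
have T3 : L * al `^ s * (1 + CC / Num.sqrt N / al) <= L * C `^ s * (1 + CC / c) * r.
  have als : al `^ s <= C `^ s * r.
    rewrite -us -powRM ?(ltW C0) ?(ltW u0)// ge0_ler_powR ?nnegrE ?(ltW al0)//.
    by rewrite mulr_ge0// ltW.
  have CCc : CC / Num.sqrt N / al <= CC / c.
    rewrite -mulrA; apply: ler_wpM2l => //; rewrite sN.
    rewrite ler_pdivrMr// ler_pdivlMl//.
    apply: le_trans cal; rewrite mulrCA -[leRHS]mul1r ler_wpM2r// ltW//.
  rewrite [leRHS]mulrAC -(mulrA L (C `^ s)) -!mulrA; apply: ler_wpM2l => //.
  rewrite mulrA [leRHS]mulrA; apply: ler_pM.
  - exact: powR_ge0.
  - by rewrite addr_ge0// !mulr_ge0// ?invr_ge0 ?sqrtr_ge0// ltW.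
  - by [].
  - by rewrite lerD2l.
have T3' : (L * al `^ s * (1 + CC / Num.sqrt N / al)) ^+ 2 * HF <=
    (L * C `^ s * (1 + CC / c)) ^+ 2 * HF * r ^+ 2.
  rewrite [leRHS]mulrAC -exprMn; apply: ler_wpM2r => //.
  apply: sqr_le => //; apply: mulr_ge0; first by rewrite mulr_ge0 ?powR_ge0.
  by rewrite addr_ge0// !mulr_ge0// ?invr_ge0 ?sqrtr_ge0// ltW.
rewrite -[leRHS]mulrA; apply: ler_wpM2l => //.
by rewrite [leRHS]mulrDl [X in _ <= X + _]mulrDl; apply: lerD => //; apply: lerD.
Qed.

(** The last two identities express the balance: the bias u^s equals r, and so does the noise level
    n^(-1/2) / u. Together they determine both exponents. *)
Lemma rate_exponents (s : R) (n : nat) : (0 < n)%N -> 0 <= s ->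
  let u := n%:R `^ (- (2 * (s + 1))^-1) in
  let r := n%:R `^ (- (s / (2 * (s + 1)))) in
  [/\ 0 < u <= 1, 0 < r <= 1, u `^ s = r & (r * u) ^+ 2 * n%:R = 1].
Proof.
move=> n0 s0 u r.
have nR0 : 0 < n%:R :> R by rewrite ltr0n.
have d0 : 0 < 2 * (s + 1) by rewrite mulr_gt0// ltr_wpDl.
have n1 : 1 <= n%:R :> R by rewrite ler1n.
have le1 (x : R) : 0 <= x -> 0 < n%:R `^ (- x) <= 1.
  move=> x0; rewrite powR_gt0//=.
  by rewrite -[leRHS](powRr0 n%:R) ler_powR// oppr_le0.
split.
- by apply: le1; rewrite invr_ge0 ltW.
- by apply: le1; rewrite divr_ge0// ltW.
- by rewrite /u -powRrM /r; congr (_ `^ _); rewrite mulNr mulrC.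
- rewrite /r /u -powRD ?lt0r_neq0 ?implybT// -powR_mulrn ?powR_ge0// -powRrM.
  rewrite -[X in _ * X]powRr1 ?(ltW nR0)// -powRD ?lt0r_neq0 ?implybT//.
  rewrite (_ : _ + 1 = 0) ?powRr0//; field.
  by rewrite lt0r_neq0// ltr_wpDl.
Qed.

End error_rate_arith.

Section far1_rate.
Context {R : realType} {V : preHilbertType R}.
Context d (Omega : measurableType d) (P : probability Omega R).

Lemma markov_ge0 (f : Omega -> \bar R) (m a : R) : measurable_fun setT f ->
  (forall w, (0 <= f w)%E) -> (\int[P]_w f w <= m%:E)%E -> 0 < a ->
  measurable [set w | (a%:E < f w)%E] /\ (P [set w | (a%:E < f w)%E] <= (m / a)%:E)%E.
Proof.
move=> mf f0 fm a0; set A := [set w | _].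
have mA : measurable A by rewrite /A -[X in measurable X]setTI; exact: emeasurable_fun_o_infty.
split => //.
have := le_integral_abse P measurableT mf a0.
under eq_integral do rewrite gee0_abs//.
rewrite setTI => /le_trans /(_ fm) H.
have AB : A `<=` [set x | (a%:E <= `|f x|)%E].
  by move=> w /= /ltW; rewrite gee0_abs.
rewrite EFinM lee_pdivlMr//.
apply: le_trans H; rewrite muleC; apply: lee_wpmul2l; first by rewrite lee_fin ltW.
apply: le_measure => //; rewrite inE// -[X in measurable X]setTI.
by apply: emeasurable_fun_c_infty => //; exact: measurableT_comp.
Qed.

Let le_setU (A B : set Omega) (a b : R) :
  measurable A /\ (P A <= a%:E)%E -> measurable B /\ (P B <= b%:E)%E ->
  measurable (A `|` B) /\ (P (A `|` B) <= (a + b)%:E)%E.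
Proof.
move=> [mA PA] [mB PB]; split; first exact: measurableU.
by rewrite EFinD; apply: le_trans (leeD PA PB); exact: measureU2.
Qed.

Variables (b : nat -> V) (Psi C0 : {linear V -> V}) (q : R).
Variables (eps X : int -> Omega -> V).
Hypothesis bb : orthonormal_basis b.
Hypothesis q01 : 0 <= q < 1.
Hypothesis Psiq : forall x, `|Psi x| <= q * `|x|.
Hypothesis hX : far1_causal_solution P Psi eps X.
Hypothesis hC0 : forall t, is_covariance_operator P (X t) C0.
Hypothesis heps : iid P (eps : int -> Omega -> borel V).
Hypothesis heps0 : forall t, is_expectation P (eps t) 0.
Hypothesis heps4 : forall t, finite_moment4 P (eps t).
Hypothesis X4 : forall t, finite_moment4 P (X t).

(** Markov's inequality for five nonnegative variables, with means bounded by a constant or by a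
    constant times n, together with the null set where some instance of the recursion fails. This
    scaling lets one [K] serve every n. *)
Lemma far1_good_event (p : R) : 0 < p -> exists2 K : R, 0 < K &
  forall n, (1 < n)%N -> exists B, [/\ measurable B, (P B <= p%:E)%E &
    forall w, ~ B w ->
      [/\ forall t : nat, X t.+1%:Z w = Psi (X t%:Z w) + eps t.+1%:Z w,
          `|X 1%N w| ^+ 2 <= K, `|X n%:Z w| ^+ 2 <= K,
          `|\sum_(1 <= t < n) eps t.+1%:Z w| ^+ 2 <= K * n%:R &
      (hs2 b (fun v => (\sum_(1 <= t < n) tensor (eps t.+1%:Z w) (X t%:Z w) v)%R)
         <= (K * n%:R)%:E)%E /\
      (\sum_(0 <= k <oo) \sum_(0 <= l <oo)
         ((\sum_(1 <= t < n) (inner (eps t.+1%:Z w) (b k) * inner (eps t.+1%:Z w) (b l)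
            - innovation_cov P eps (b k) (b l))) ^+ 2)%:E <= (K * n%:R)%:E)%E]].
Proof.
move=> p0.
have tX0 : 0 <= far1_moment2 P X := moment2_ge0 (far1_moment2E hX X4 0).
have s20 : 0 <= innovation_moment2 P eps := moment2_ge0 (innovation_moment2E heps heps4 0).
have s40 : 0 <= innovation_moment4 P eps.
  rewrite -lee_fin -(innovation_moment4E heps heps4 0).
  by apply: integral_ge0 => w _; rewrite lee_fin.
set tX := far1_moment2 P X in tX0 *; set s2 := innovation_moment2 P eps in s20 *.
set s4 := innovation_moment4 P eps in s40 *.
(* The five Markov bounds add up to k / K, the moment of X counting for both X_1 and X_n; K = k / p
   + 1 is positive and makes the sum at most p. *)
pose k := tX + tX + s2 + tX * s2 + s4.
have k0 : 0 <= k by rewrite !addr_ge0// mulr_ge0.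
have K0 : 0 < k / p + 1 by rewrite ltr_wpDl// divr_ge0// ltW.
set K := k / p + 1 in K0 *.
exists K => // n n1.
have nR0 : 0 < n%:R :> R by rewrite ltr0n (ltn_trans _ n1).
have Kn0 : 0 < K * n%:R by rewrite mulr_gt0.
have /ae_foralln [N [mN N0 Nrec]] : forall t : nat,
    {ae P, forall w, X t.+1%:Z w = Psi (X t%:Z w) + eps t.+1%:Z w}.
  move=> t; case: hX => _ _ /(_ t.+1%:Z) rec _.
  by apply: filterS rec => w ->; rewrite -addn1 PoszD addrK.
have BX t : measurable [set w | (K%:E < (`|X t w| ^+ 2)%:E)%E] /\
    (P [set w | (K%:E < (`|X t w| ^+ 2)%:E)%E] <= (tX / K)%:E)%E.
  apply: markov_ge0 => //.
  - apply/measurable_EFinP; apply: measurable_funX.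
    exact: measurable_norm_elt (measurable_far1 hX t).
  - by rewrite (far1_moment2E hX X4).
have BU := markov_ge0 (measurable_innovation_sum bb heps n) _
  (innovation_sum_moment bb heps heps0 heps4 n) Kn0.
have BG := markov_ge0 (measurable_cross_sum bb hX heps n) (fun w => hs2_ge0 _ _)
  (cross_sum_moment bb Psiq hX hC0 heps heps0 heps4 X4 n) Kn0.
have W0 w : (0 <= \sum_(0 <= k <oo) \sum_(0 <= l <oo)
    ((\sum_(1 <= t < n) (inner (eps t.+1%:Z w) (b k) * inner (eps t.+1%:Z w) (b l)
       - innovation_cov P eps (b k) (b l))) ^+ 2)%:E)%E.
  apply: nneseries_ge0 => i _ _; apply: nneseries_ge0 => j _ _.
  by rewrite lee_fin sqr_ge0.
have BW := markov_ge0 (measurable_cov_sum b heps n) W0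
  (cov_sum_moment bb heps heps4 n) Kn0.
have BN : measurable N /\ (P N <= 0%:E)%E by rewrite N0.
have [mB PB] := le_setU BN (le_setU (BX 1%N) (le_setU (BX n)
  (le_setU (BU (fun w => sqr_ge0 _)) (le_setU BG BW)))).
eexists; split; [exact: mB| |].
  apply: le_trans PB _; rewrite lee_fin.
  have -> : 0 + (tX / K + (tX / K + (n%:R * s2 / (K * n%:R) +
     (n%:R * (tX * s2) / (K * n%:R) + n%:R * s4 / (K * n%:R))))) = k / K.
    by rewrite /k; field; rewrite !lt0r_neq0.
  rewrite ler_pdivrMr// /K mulrDr mulr1 mulrC divfK ?lt0r_neq0//.
  by rewrite lerDl ltW.
move=> w /not_orP[wN] /not_orP[w1] /not_orP[wn] /not_orP[wU] /not_orP[wG] wW.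
split; first by apply: contrapT => /Nrec.
- by move/negP: w1; rewrite -leNgt lee_fin.
- by move/negP: wn; rewrite -leNgt lee_fin.
- by move/negP: wU; rewrite -leNgt lee_fin.
- by split; [move/negP: wG|move/negP: wW]; rewrite -leNgt.
Qed.

Lemma far1_basis_rate (F Cb : {linear V -> V}) (beta : R) (alpha : nat -> R) :
  continuous Psi -> continuous F -> (hs2 b Psi < +oo)%E -> (hs2 b F < +oo)%E ->
  0 < beta -> is_operator_power C0 beta Cb -> Psi =1 F \o Cb ->
  asymp alpha (fun n => n%:R `^ (- (2 * (Num.min beta 1 + 1))^-1)) ->
  bigO_P P (fun n w => sqrte (hs2 b (fun y =>
      far1_estimator (X ^~ w) n (alpha n) y - Psi y)))
    (fun n => n%:R `^ (- (Num.min beta 1 / (2 * (Num.min beta 1 + 1))))).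
Proof.
move=> cPsi cF hsPsi hsF beta0 [lam [e [eig Cbe]]] PsiF
  [c [C [c0 cC asym]]] p p0.
set s := Num.min beta 1 in asym *.
have s0 : 0 <= s by rewrite le_min (ltW beta0) ler01.
have [K K0 good] := far1_good_event p0.
have tX0 : 0 <= far1_moment2 P X := moment2_ge0 (far1_moment2E hX X4 0).
have s20 : 0 <= innovation_moment2 P eps := moment2_ge0 (innovation_moment2E heps heps4 0).
have q1 : 0 < 1 - q by rewrite subr_gt0; case/andP: q01.
have iq0 : 0 <= (1 - q)^-1 by rewrite invr_ge0 ltW.
have q0 : 0 <= q by case/andP: q01.
pose NC := noise_const q K; pose CC := cov_const q (innovation_moment2 P eps) K.
have NC0 : 0 <= NC.
  apply: mulr_ge0 => //; apply: addr_ge0; [apply: addr_ge0; first exact: ltW|];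
    by rewrite mulr_ge0 ?sqr_ge0.
have CC0 : 0 <= CC.
  have K0' := ltW K0.
  rewrite /CC /cov_const addr_ge0// ?divr_ge0 ?mulr_ge0 ?sqr_ge0//.
  - by rewrite !addr_ge0// mulr_ge0// sqrtr_ge0.
  - by rewrite subr_ge0 exprn_ile1//; case/andP: q01 => _ /ltW.
pose HP := fine (hs2 b Psi); pose HF := fine (hs2 b F).
have HPE : hs2 b Psi = HP%:E by rewrite fineK// ge0_fin_numE// hs2_ge0.
have HFE : hs2 b F = HF%:E by rewrite fineK// ge0_fin_numE// hs2_ge0.
have HP0 : 0 <= HP by rewrite fine_ge0// hs2_ge0.
have HF0 : 0 <= HF by rewrite fine_ge0// hs2_ge0.
(* [lam 0] is the largest eigenvalue in the eigensystem that witnesses the power [Cb]. *)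
pose L := lam 0%N `^ (beta - s).
have lam0 : 0 < lam 0%N by case: eig => _ /(_ 0%N).
have L0 : 0 < L by rewrite powR_gt0.
pose M2 := 3 * (16 * HP + 4 * NC / c ^+ 2 + (L * C `^ s * (1 + CC / c)) ^+ 2 * HF).
exists (Num.sqrt M2 + 1); first by rewrite ltr_wpDl// sqrtr_ge0.
(* From n = 2 on, n - 1 is positive and 1 / (n - 1) <= 2 / n. *)
exists 2%N => // n n1.
have [B [mB PB goodB]] := good n n1.
apply: le_trans (PB); rewrite -(measurable_mu_extE P mB).
(* Monotonicity of the outer measure: the set where the error is large need not be measurable, it
   only has to lie in [B]. *)
apply: le_mu_ext => w /= err; apply: contrapT => /goodB [rec x1 xn xU [xG xW]].
move: err; apply/negP; rewrite -leNgt.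
have n0 : (0 < n)%N := ltnW n1.
have nR0 : 0 < n%:R :> R by rewrite ltr0n.
have [] := rate_exponents n0 s0.
set u := _ `^ _; set r := _ `^ _ => /andP[u0 u1] /andP[r0 r1] us run.
have /andP[cal alC] := asym n n0.
rewrite -/u in cal alC.
have al0 : 0 < alpha n by rewrite (lt_le_trans _ cal)// mulr_gt0.
have rec' : forall t : nat, (0 < t < n)%N -> X t.+1%:Z w = Psi (X t%:Z w) + eps t.+1%:Z w.
  by move=> t _.
have noise := noise_part_le (x := X ^~ w) (eps := eps ^~ w)
  bb q01 Psiq (ltW K0) n1 rec' x1 xn xU xG.
have lim g h := @covariance_operator_limit _ _ _ _ _ _ _ _ _ _ _ bb q01 Psiq hX hC0 heps
  heps0 heps4 X4 g h.
have dev := sample_cov0_deviation (x := X ^~ w) (eps := eps ^~ w) bb q01 Psiq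
  lim tX0 s20 (ltW K0) (covariance_operator_bound hX hC0 X4) (innovation_cov_bound heps heps4)
  (innovation_cov_linear heps heps4) (innovation_cov_sym P eps) n1 rec' x1 xn xU xG xW.
rewrite -/NC in noise; rewrite -/CC in dev.
have Lal0 : 0 < L * alpha n `^ s by rewrite mulr_gt0// powR_gt0.
have del0 : 0 <= CC / Num.sqrt n%:R by rewrite divr_ge0// sqrtr_ge0.
have Cb_le y z : C0 y + alpha n *: y = z -> alpha n * `|Cb y| <= L * alpha n `^ s * `|z|.
  exact: (operator_power_bound (covariance_operator_sym hC0) eig al0 beta0 (Cbe y)).
have E := far1_error_hs2 (x := X ^~ w) (eps := eps ^~ w) n1 rec' bb cPsi cF PsiF
  al0 Lal0 del0 Cb_le dev.
have M20 : 0 <= M2.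
  apply: mulr_ge0 => //; apply: addr_ge0; last by apply: mulr_ge0 => //; exact: sqr_ge0.
  apply: addr_ge0; first exact: mulr_ge0.
  by apply: divr_ge0; [apply: mulr_ge0|exact: sqr_ge0].
have E2 : (hs2 b (fun y => (far1_estimator (X ^~ w) n (alpha n) y - Psi y)%R) <=
    ((Num.sqrt M2 * r) ^+ 2)%:E)%E.
  apply: le_trans E _; rewrite HPE HFE.
  apply: (@le_trans _ _ (3%:E * ((n.-1%:R^-1 ^+ 2 * 4)%:E * HP%:E +
     (n.-1%:R^-1 ^+ 2 * (alpha n)^-1 ^+ 2)%:E * (NC * n%:R)%:E +
     ((L * alpha n `^ s * (1 + CC / Num.sqrt n%:R / alpha n)) ^+ 2)%:E * HF%:E))%E).
    apply: lee_wpmul2l => //; apply: leeD => //; apply: leeD => //.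
    by apply: lee_wpmul2l => //; rewrite lee_fin mulr_ge0// sqr_ge0.
  rewrite -[leLHS]/(_%:E) lee_fin [leRHS]exprMn [Num.sqrt M2 ^+ 2]sqr_sqrtr//.
  apply: (@error_rate_arith _ u r) => //; [|exact: ltW].
  rewrite ler_pdivrMl ?ltr0n -?subn1 ?subn_gt0// -natrM ler_nat.
  by rewrite -[leqLHS](subnK n0) muln2 -addnn leq_add2l subn_gt0.
rewrite gee0_abs ?sqrte_ge0//.
apply: (@le_trans _ _ (sqrte ((Num.sqrt M2 * r) ^+ 2)%:E)).
  by rewrite lee_sqrt// lee_fin sqr_ge0.
rewrite /= sqrtr_sqr ger0_norm ?mulr_ge0 ?sqrtr_ge0 ?(ltW r0)//.
by rewrite lee_fin ler_wpM2r ?(ltW r0)// lerDl.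
Qed.
End far1_rate.

(** By homogeneity, with q the operator norm itself, a real number since it lies between 0 and 1. *)
Lemma op_norm_lt1 (R : realType) (V : preHilbertType R) (A : {linear V -> V}) :
  (op_norm A < 1)%E -> exists q : R, 0 <= q < 1 /\ forall x, `|A x| <= q * `|x|.
Proof.
move=> A1; have ub (x : V) : `|x| <= 1 -> (`|A x|%:E <= op_norm A)%E.
  by move=> x1; apply: ereal_sup_ubound; exists x.
have A0 : (0 <= op_norm A)%E 
  by apply: le_trans (ub 0 _); rewrite ?normr0// lee_fin.
have AE : op_norm A = (fine (op_norm A))%:E.
  by rewrite fineK// ge0_fin_numE// (lt_trans A1) ?ltry.
exists (fine (op_norm A)); split.
  by rewrite fine_ge0//= -lte_fin -AE.
move=> x; have [->|x0] := eqVneq x 0; first by rewrite linear0 !normr0 mulr0.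
have nx0 : 0 < `|x| by rewrite normr_gt0.
have := ub (`|x|^-1 *: x); rewrite normrZ ger0_norm ?invr_ge0// mulVf ?lt0r_neq0// => /(_ (lexx _)).
by rewrite AE lee_fin linearZ normrZ ger0_norm ?invr_ge0// ler_pdivrMl// mulrC.
Qed.

(** For the degenerate case in which [hs_norm] evaluates its operator at 0 only. *)
Lemma far1_estimator0 (R : realType) (V : preHilbertType R) (x : int -> V) (n : nat) (a : R) :
  0 < a -> far1_estimator x n a 0 = 0.
Proof.
move=> a0; rewrite /far1_estimator /= sample_cov0_ridge.
have c0 : 0 <= n%:R^-1 :> R by rewrite invr_ge0.
have [B [-> _ _]] := ridge_pinv (centered x n) c0 a0.
rewrite linear0 /sample_cov1 /= -[LHS]/(_ *: _) fct_sumE big1 ?scaler0// => t _.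
exact: linear0.
Qed.

Lemma sqrte_lty (R : realType) (x : \bar R) : (sqrte x < +oo)%E -> (x < +oo)%E.
Proof. by case: x => //= x _; rewrite ltry. Qed.

Theorem theorem1 (R : realType) (d : measure_display)
  (Omega : measurableType d) (P : probability Omega R)
  (Psi : L2_01 R -> L2_01 R) (eps X : int -> Omega -> L2_01 R)
  (C0 : L2_01 R -> L2_01 R)
  (lam : nat -> R) (e : nat -> L2_01 R) (a c1 c2 : R)
  (beta rho : R) (F C0beta : L2_01 R -> L2_01 R) (alpha : nat -> R)
  (hPsi : hilbert_schmidt Psi)
  (hX : far1_causal_solution P Psi eps X)
  (hC0 : forall t, is_covariance_operator P (X t) C0)
  (hPsi1 : (op_norm Psi < 1)%E)
  (heps : iid P (eps : int -> Omega -> borel (L2_01 R)))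
  (heps0 : forall t, is_expectation P (eps t) 0)
  (heps4 : forall t, finite_moment4 P (eps t))
  (hC0inj : injective C0) (hC0cpt : compact_operator C0)
  (hC0tr : trace_class C0) (hlam : eigensystem C0 lam e)
  (hc1 : 0 < c1) (hc12 : c1 <= c2) (ha : 1 < a)
  (hdecay : forall k : nat,
     c1 * k.+1%:R `^ (- a) <= lam k <= c2 * k.+1%:R `^ (- a))
  (hbeta : 0 < beta) (hF : hilbert_schmidt F) (hFrho : (hs_norm F <= rho%:E)%E)
  (hC0beta : is_operator_power C0 beta C0beta) (hsrc : Psi = F \o C0beta)
  (hX4 : L4_m_approximable P X)
  (halpha : forall n, 0 < alpha n)
  (halpha_rate :
     asymp alpha (fun n => n%:R `^ (- (2 * (Num.min beta 1 + 1))^-1))) :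
  let err n w := hs_norm (far1_estimator (X ^~ w) n (alpha n) - Psi) in
  [/\ bigO_P P err
        (fun n => n%:R `^ (- (Num.min beta 1 / (2 * (Num.min beta 1 + 1))))),
      1 <= beta -> bigO_P P err (fun n => n%:R `^ (- 4^-1)) &
      beta <= 1 -> bigO_P P err (fun n => n%:R `^ (- (beta / (2 * (beta + 1)))))].
Proof.
move=> err.
have X4 t : finite_moment4 P (X t) by case: hX4 => ? [? [? [? [? [? [? [? [? []]]]]]]]].
have rate : bigO_P P err
    (fun n => n%:R `^ (- (Num.min beta 1 / (2 * (Num.min beta 1 + 1))))).
  pose lin (A : L2_01 R -> L2_01 R) (linA : linear A) : {linear L2_01 R -> L2_01 R} :=
    HB.pack A (GRing.isLinear.Build R _ _ _ A linA).
  pose Psil := lin Psi hPsi.1.1; pose Fl := lin F hF.1.1; pose C0l := lin C0 hC0cpt.1.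
  pose Cbl := lin C0beta (operator_power_linear hC0beta).
  have [q [q01 Psiq]] := op_norm_lt1 (A := Psil) hPsi1.
  (* [hs_norm] picks its basis by [xget], which returns an orthonormal basis only if there is one;
     both cases are settled. *)
  have [exb|nob] := pselect (exists b : nat -> L2_01 R, orthonormal_basis b).
    have := xgetPex (fun=> 0) exb; set b := xget _ _ => bb.
    have hs A : hs_norm A = sqrte (hs2 b A) by [].
    have hsP : (hs2 b Psi < +oo)%E by apply: sqrte_lty; rewrite -hs; exact: hPsi.2.
    have hsF : (hs2 b F < +oo)%E by apply: sqrte_lty; rewrite -hs; exact: hF.2.
    have PF : Psi =1 F \o C0beta by move=> x; rewrite {1}hsrc.
    have -> : err = fun n w => sqrte (hs2 b (fun y =>
        far1_estimator (X ^~ w) n (alpha n) y - Psi y)).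
      by apply/funext => n; apply/funext => w; exact: hs.
    exact: (@far1_basis_rate _ _ _ _ P b Psil C0l q eps X bb q01 Psiq hX hC0 heps heps0
      heps4 X4 Fl Cbl beta alpha hPsi.1.2 hF.1.2).
  (* without an orthonormal basis, [hs_norm A] is the junk value computed from
     [A 0] alone *)
  have nob' (b : nat -> L2_01 R) : ~ orthonormal_basis b by move=> ?; apply: nob; exists b.
  have err0 n w : err n w = 0.
    rewrite /err /hs_norm (xgetPN (fun=> 0) nob') eseries0 ?sqrte0// => k _ _.
    rewrite -[X in (`|X| ^+ 2)%:E]/(far1_estimator (X ^~ w) n (alpha n) 0 - Psil 0).
    by rewrite far1_estimator0// linear0 subr0 normr0 expr0n.
  move=> p p0; exists 1 => //; apply: nearW => n.
  rewrite [X in (P^*)%mu X](_ : _ = set0) ?mu_ext0 ?lee_fin ?ltW//.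
  by rewrite -subset0 => w /=; rewrite err0 abse0 mul1r lte_fin ltNge powR_ge0.
split=> [|b1|b1]; first exact: rate.
- have <- : Num.min beta 1 / (2 * (Num.min beta 1 + 1)) = 4^-1 by rewrite min_r//; field.
  exact: rate.
- have <- : Num.min beta 1 / (2 * (Num.min beta 1 + 1)) = beta / (2 * (beta + 1)).
    by rewrite min_l.
  exact: rate.
Qed.
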